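(* Let $(\lambda_n)_{n\in\mathbb{N}_0}\subseteq(0,1)$ with $\lim_{n\to\infty}\lambda_{2n}=1$ satisfy both $\lambda_{2n-2}+\lambda_{2n-1}\leq\lambda_{2n}$ and $\lambda_{2n-1}+\lambda_{2n}\leq\lambda_{2n+2}$ for every $n\in\mathbb{N}$, and let $(Q_n(x))_{n\in\mathbb{N}_0}\subseteq\mathbb{R}[x]$ be given by the recurrence relation $Q_0(x)=1$, $Q_1(x)=x/\lambda_0$, $$xQ_n(x)=\lambda_nQ_{n+1}(x)+\lambda_{n-1}Q_{n-1}(x)\quad(n\in\mathbb{N}).$$ The following hold: (i) The sequence $(Q_n(1))_{n\in\mathbb{N}_0}$ is strictly positive and strictly increasing. (ii) The sequence $(P_n(x))_{n\in\mathbb{N}_0}$ defined by $P_n(x):=Q_n(x)/Q_n(1)$ $(n\in\mathbb{N}_0)$ satisfies nonnegative linearization of products, and $(Q_n(x))_{n\in\mathbb{N}_0}$ are the orthonormal polynomials which correspond to $(P_n(x))_{n\in\mathbb{N}_0}$. (iii) The dual space $\widehat{\mathbb{N}_0}$ (of $(P_n(x))_{n\in\mathbb{N}_0}$) satisfies $$\widehat{\mathbb{N}_0}=\mathrm{supp}\,\mu=\{\pm1\}\cup\{\pm x_n:n\in\mathbb{N}\}$$ with a strictly increasing sequence $(x_n)_{n\in\mathbb{N}}\subseteq(0,1)$ with $\lim_{n\to\infty}x_n=1$. (iv) For every $\epsilon\in(0,1)$, the sequence $(\lambda_n)_{n\in\mathbb{N}_0}$ can be chosen in such a way that the polynomial hypergroup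 induced by $(P_n(x))_{n\in\mathbb{N}_0}$ fulfills $h(1)=1+\epsilon$; in that case, one has $(x_n)_{n\in\mathbb{N}}\subseteq[\sqrt{(1-\epsilon)/(1+\epsilon)},1)$. An explicit construction is as follows: let $(s_n)_{n\in\mathbb{N}_0}\subseteq(0,1)$ be any null sequence which is convex (i.e., $s_{n+1}\leq(s_n+s_{n+2})/2$ for all $n\in\mathbb{N}_0$). Then the sequence $(\lambda_n)_{n\in\mathbb{N}_0}\subseteq\mathbb{R}$ given by $$\lambda_n:=\begin{cases}1-s_{\frac{n}{2}}, & n\text{ even},\\ s_{\frac{n+1}{2}}-s_{\frac{n+3}{2}}, & n\text{ odd}\end{cases}$$ satisfies the conditions imposed on $(\lambda_n)_{n\in\mathbb{N}_0}$ at the beginning, and if $s_0=1-1/\sqrt{1+\epsilon}$, then $h(1)=1+\epsilon$. (v) For any choice of $(\lambda_n)_{n\in\mathbb{N}_0}$ (satisfying the conditions at the beginning), the polynomial hypergroup induced by $(P_n(x))_{n\in\mathbb{N}_0}$ satisfies $h(n)>4$ for all $n\geq 2$. Moreover, $h$ is strictly increasing and of exponential growth, i.e., there are constants $C>0$ and $q>1$ such that $h(n)\geq Cq^n$ for all $n\in\mathbb{N}_0$.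
   Context: $\mathbb{N}=\{1,2,3,\ldots\}$ and $\mathbb{N}_0=\mathbb{N}\cup\{0\}$. The sequence $(P_n(x))_{n\in\mathbb{N}_0}$ of the claim is of the form $P_0(x)=1$, $P_1(x)=x$, $xP_n(x)=a_nP_{n+1}(x)+c_nP_{n-1}(x)$ $(n\in\mathbb{N})$ with $(c_n)_{n\in\mathbb{N}}\subseteq(0,1)$ and $a_n=1-c_n$. Any such sequence is orthogonal with respect to a unique probability Borel measure $\mu$ on $\mathbb{R}$ (the orthogonalization measure), meaning that $\int_{\mathbb{R}}P_m(x)P_n(x)\,\mathrm{d}\mu(x)\neq 0\Leftrightarrow m=n$, and the corresponding orthonormal polynomials are the polynomials with positive leading coefficients which are orthonormal with respect to $\mu$. Nonnegative linearization of products means that in the (unique) expansions $P_m(x)P_n(x)=\sum_{k=0}^{m+n}g(m,n;k)P_k(x)$ all coefficients $g(m,n;k)$ are nonnegative; in this case, the sequence is said to induce a polynomial hypergroup on $\mathbb{N}_0$ (with convolution $(m,n)\mapsto\sum_{k=|m-n|}^{m+n}g(m,n;k)\delta_k$, the identity as involution and unit element $0$). The dual space is $\widehat{\mathbb{N}_0}:=\{x\in\mathbb{R}:\max_{n\in\mathbb{N}_0}|P_n(x)|=1\}$. The Haar function is $h(n):=1/g(n,n;0)=1/\int_{\mathbb{R}}P_n^2(x)\,\mathrm{d}\mu(x)$; equivalently, $h(0)=1$ and $h(n)=\prod_{k=1}^n a_{k-1}/c_k$ for $n\in\mathbb{N}$, where $a_0:=1$. *)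

(* Defs.v *)
From HB Require Import structures.
From mathcomp Require Import all_boot all_order all_algebra.
From mathcomp Require Import all_classical all_reals all_analysis.
Set Implicit Arguments.
Unset Strict Implicit.
Unset Printing Implicit Defensive.
Import Order.TTheory GRing.Theory Num.Theory.
Import numFieldNormedType.Exports.
Local Open Scope classical_set_scope.
Local Open Scope ring_scope.

Section PolynomialSequences.
Context {R : realType}.
Implicit Types (P Q : nat -> {poly R}) (mu : probability (measurableTypeR R) R).

Definition normalized_recurrence P : Prop :=
  [/\ P 0%N = 1, P 1%N = 'X &
    exists c : nat -> R, forall n : nat, (1 <= n)%N ->
      [/\ 0 < c n, c n < 1 &
          'X * P n = (1 - c n) *: P n.+1 + c n *: P n.-1]].

Definition is_linearization P (m n : nat) (g : nat -> R) : Prop :=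
  (forall k : nat, (m + n < k)%N -> g k = 0) /\
  P m * P n = \sum_(k < (m + n).+1) g k *: P k.

(* g(m,n;k). The default value of [xget] is never used for sequences with
   deg P_n = n, for which the expansion exists and is unique. *)
Definition lin_coef P (m n : nat) : nat -> R :=
  xget (fun=> 0 : R) [set g : nat -> R | is_linearization P m n g].

(* The first conjunct excludes the default value of [lin_coef]. *)
Definition nonneg_linearization P : Prop :=
  forall m n : nat, is_linearization P m n (lin_coef P m n) /\
                    forall k : nat, 0 <= lin_coef P m n k.

Definition induces_polynomial_hypergroup P : Prop :=
  normalized_recurrence P /\ nonneg_linearization P.

Definition haar P (n : nat) : R := (lin_coef P n n 0%N)^-1.

(* max_n |P_n(x)| = 1, with the maximum attained. *)
Definition dual_space P : set R :=
  [set x : R | (exists n : nat, `|(P n).[x]| = 1) /\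
               (forall n : nat, `|(P n).[x]| <= 1)].

Definition poly_integrable mu P : Prop :=
  forall m n : nat,
    mu.-integrable setT (fun x : R => ((P m).[x] * (P n).[x])%:E).

Definition poly_inner mu (p q : {poly R}) : \bar R :=
  (\int[mu]_(x in [set: R]) (p.[x] * q.[x])%:E)%E.

(* Integrability is required explicitly because the library's integral is a
   total function. *)
Definition orthogonalization_measure P mu : Prop :=
  poly_integrable mu P /\
  forall m n : nat, poly_inner mu (P m) (P n) <> 0%E <-> m = n.

Definition orthonormal_polynomials mu Q : Prop :=
  [/\ forall n : nat, size (Q n) = n.+1,
      forall n : nat, 0 < lead_coef (Q n),
      poly_integrable mu Q &
      forall m n : nat, poly_inner mu (Q m) (Q n) = ((m == n)%:R : R)%:E].

Definition measure_support mu : set R :=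
  [set x : R | forall U : set R, open U -> U x -> (0 < mu U)%E].

End PolynomialSequences.

Section Construction.
Context {R : realType}.
Implicit Types lam s x : nat -> R.

Definition admissible lam : Prop :=
  [/\ forall n : nat, 0 < lam n < 1,
      lam (2 * n)%N @[n --> \oo] --> (1 : R) &
      forall n : nat, (1 <= n)%N ->
        lam (2 * n - 2)%N + lam (2 * n - 1)%N <= lam (2 * n)%N /\
        lam (2 * n - 1)%N + lam (2 * n)%N <= lam (2 * n + 2)%N].

Fixpoint Qpoly lam (n : nat) : {poly R} :=
  match n with
  | 0 => 1
  | n1.+1 =>
      match n1 with
      | 0 => (lam 0%N)^-1 *: 'X
      | n2.+1 => (lam n1)^-1 *: ('X * Qpoly lam n1 - lam n2 *: Qpoly lam n2)
      end
  end.

Lemma Qpoly_recurrence lam : (forall n : nat, lam n != 0) ->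
  forall n : nat, (1 <= n)%N ->
    'X * Qpoly lam n = lam n *: Qpoly lam n.+1 + lam n.-1 *: Qpoly lam n.-1.
Proof.
move=> lam0 [//|n] _ /=.
by rewrite scalerA mulfV // scale1r subrK.
Qed.

Definition Ppoly lam (n : nat) : {poly R} :=
  ((Qpoly lam n).[1])^-1 *: Qpoly lam n.

Definition strictly_increasing x : Prop := forall n : nat, x n < x n.+1.

(* Indexed from 0: [x n] is the point x_(n+1). *)
Definition node_sequence x : Prop :=
  [/\ strictly_increasing x, forall n : nat, 0 < x n < 1 &
      x n @[n --> \oo] --> (1 : R)].

Definition node_set x : set R :=
  [set y : R | [\/ y = 1, y = -1 | exists n : nat, y = x n \/ y = - x n]].

Definition convex_null_sequence s : Prop :=
  [/\ forall n : nat, 0 < s n < 1,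
      s n @[n --> \oo] --> (0 : R) &
      forall n : nat, s n.+1 <= (s n + s n.+2) / 2].

Definition lam_of s (n : nat) : R :=
  if odd n then s ((n + 1) %/ 2)%N - s ((n + 3) %/ 2)%N
  else 1 - s (n %/ 2)%N.

End Construction.

(* Main.v *)
Require Import Defs.
From HB Require Import structures.
From mathcomp Require Import all_boot all_order all_algebra.
From mathcomp Require Import all_classical all_reals all_analysis.
From mathcomp Require Import measurable_realfun zify ring lra.
Import Order.TTheory GRing.Theory Num.Theory.
Import numFieldNormedType.Exports.
Set Implicit Arguments.
Unset Strict Implicit.
Unset Printing Implicit Defensive.
Local Open Scope classical_set_scope.
Local Open Scope ring_scope.

(* The even-indexed parameters increase to 1 and the odd-indexed ones are
   squeezed into their gaps, so the Jacobi matrix J almost decouples. The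
   diagonal entries of J^2 increase so fast that, in the order given by the
   cone of nonnegative combinations of the P_k, the products Q_(2n) Q_j
   (j >= 2n) increase with n; this is nonnegative linearization. At a point
   |x| < 1 the recurrence for Q_(2n)(x) either makes Q_(2n)(x) decay
   geometrically or makes it outgrow Q_(2n)(1), so the dual space inside (-1,1)
   consists of the points of the first kind. The Christoffel-Darboux kernel
   shows that such points lie in the support and that they are uniformly
   separated away from 1 and -1; conversely, nonnegative linearization bounds
   all moments of P_n by 1, so the support lies in the dual space. The points
   accumulate at 1 because the integral of x^2 Q_(2n)^2 tends to 1. *)

(** * Expansions in a graded family and the cone they span *)

(** J has zero diagonal, so multiplication by X offers no diagonal terms to compare. Its square
    preserves parity: the Q_(2n) alone satisfy a three-term recurrence in x^2, and odd indices are
    recovered from neighbouring even ones by one multiplication with X. In operator terms,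
    [lam n.*2 -> 1] and [lam n.*2.+1 -> 0] make J^2 - 1 compact, so the spectrum can accumulate only
    at 1 and -1. Finite kernels take the place of spectral theory. Truncating the formal eigenvector
    (Q_k(x)) leaves a boundary term that decays geometrically, so x cannot have a null
    neighbourhood. The eigenvectors of two distinct points are orthogonal in the limit, yet all have
    first entry Q_0 = 1, so the points cannot be close. The estimates must be uniform on |x| <= r,
    because accumulation below 1 has to be excluded before the points can be listed in increasing
    order. They degenerate at 1 and -1, where mass is excluded by the growth of Q_(2n)(1)
    instead. *)

Section Expansion.
Context {R : realType}.
Implicit Types (F : nat -> {poly R}) (c p q : {poly R}).

(** The polynomial [c] only encodes a finitely supported coefficient sequence, so that expansions
    can be added and compared without index bounds. *)
Definition combination F c : {poly R} := \sum_(k < size c) c`_k *: F k.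

Lemma combination_widen F c N : (size c <= N)%N ->
  combination F c = \sum_(k < N) c`_k *: F k.
Proof.
move=> cN; rewrite /combination -!(big_mkord xpredT (fun k => c`_k *: F k)).
rewrite (big_cat_nat (n := size c) _ cN) //= [X in _ = _ + X]big1_seq ?addr0 //.
move=> i /andP[_]; rewrite mem_index_iota => /andP[ci _].
by rewrite nth_default // scale0r.
Qed.

Lemma combinationD F c1 c2 :
  combination F (c1 + c2) = combination F c1 + combination F c2.
Proof.
pose N := maxn (size c1) (size c2).
rewrite !(@combination_widen F _ N) ?leq_maxl ?leq_maxr ?size_polyD //.
by rewrite -big_split; apply: eq_bigr => i _; rewrite coefD scalerDl.
Qed.

Lemma combinationZ F a c : combination F (a *: c) = a *: combination F c.
Proof.
rewrite (@combination_widen F _ (size c)) ?size_scale_leq // scaler_sumr.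
by apply: eq_bigr => i _; rewrite coefZ scalerA.
Qed.

Lemma combinationB F c1 c2 :
  combination F (c1 - c2) = combination F c1 - combination F c2.
Proof. by rewrite combinationD -scaleN1r combinationZ scaleN1r. Qed.

Lemma combinationXn F n : combination F 'X^n = F n.
Proof.
rewrite /combination size_polyXn big_ord_recr /= coefXn eqxx scale1r big1 ?add0r //.
by move=> i _; rewrite coefXn ltn_eqF // scale0r.
Qed.

(** The top term of a graded family cannot cancel. Hence [combination F] is injective, which is how
    the coefficients chosen by [xget] in [lin_coef] get identified. *)
Lemma size_combination F c : (forall n, size (F n) = n.+1) ->
  size (combination F c) = size c.
Proof.
move=> sF; rewrite /combination; case sc: (size c) => [|n].
  by rewrite big_ord0 size_poly0.
have cn0 : c`_n != 0.
  by rewrite -[n]/(n.+1.-1) -sc -lead_coefE lead_coef_eq0 -size_poly_eq0 sc.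
rewrite big_ord_recr /= addrC size_polyDl ?size_scale ?sF //.
apply: (leq_ltn_trans (size_sum _ _ _)); apply/bigmax_leqP => i _.
by rewrite (leq_trans (size_scale_leq _ _)) // sF.
Qed.

Lemma lin_coefP F m n c : (forall n, size (F n) = n.+1) ->
  F m * F n = combination F c ->
  is_linearization F m n (fun k => c`_k) /\ lin_coef F m n = (fun k => c`_k).
Proof.
move=> sF Fmn.
have F0 k : F k != 0 by rewrite -size_poly_eq0 sF.
have sc : size c = (m + n).+1.
  by rewrite -(size_combination _ sF) -Fmn size_mul // !sF addSn addnS.
have lin : is_linearization F m n (fun k => c`_k).
  split; last by rewrite Fmn /combination sc.
  by move=> k kmn; rewrite nth_default // sc.
split=> //; apply: (@xget_unique _ _ [set g | is_linearization F m n g]) => //.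
move=> g [g0 gE].
pose d := \poly_(k < (m + n).+1) g k.
have dE k : d`_k = g k by rewrite coef_poly; case: ltnP => // /g0.
have Fd : F m * F n = combination F d.
  rewrite gE (@combination_widen F d (m + n).+1) ?size_poly //.
  by apply: eq_bigr => i _; rewrite dE.
suff -> : c = d by apply/funext => k; rewrite dE.
apply/eqP; rewrite -subr_eq0 -size_poly_eq0 -(size_combination _ sF).
by rewrite combinationB -Fd Fmn subrr size_poly0.
Qed.

Definition cone F p : Prop :=
  exists2 c : {poly R}, (forall k, 0 <= c`_k) & p = combination F c.

Lemma cone_gen F k : cone F (F k).
Proof. by exists 'X^k; [move=> i; rewrite coefXn | rewrite combinationXn]. Qed.

Lemma coneD F p q : cone F p -> cone F q -> cone F (p + q).
Proof.
move=> [c c0 ->] [d d0 ->]; exists (c + d); last by rewrite combinationD.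
by move=> k; rewrite coefD addr_ge0.
Qed.

Lemma coneZ F a p : 0 <= a -> cone F p -> cone F (a *: p).
Proof.
move=> a0 [c c0 ->]; exists (a *: c); last by rewrite combinationZ.
by move=> k; rewrite coefZ mulr_ge0.
Qed.

Lemma cone0 F : cone F 0.
Proof. by rewrite -(scale0r (F 0)); apply/coneZ/cone_gen. Qed.

Lemma cone_mul F p q : (forall m n, cone F (F m * F n)) ->
  cone F p -> cone F q -> cone F (p * q).
Proof.
move=> Fmul [c c0 ->] [d d0 ->]; rewrite /combination mulr_suml.
elim/big_ind: _ => [|x y|i _]; [exact: cone0|exact: coneD|].
rewrite mulr_sumr; elim/big_ind: _ => [|x y|j _]; [exact: cone0|exact: coneD|].
by rewrite -scalerAl -scalerAr; do 2?[apply: coneZ].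
Qed.

End Expansion.

(** * Inequalities between the parameters; the rows of J and J^2 *)

Section Admissible.
Context {R : realType} (lam : nat -> R) (lam_adm : admissible lam).
Local Notation Q := (Qpoly lam).
Local Notation P := (Ppoly lam).

(* [lam n.-1] with the convention [lam (-1) = 0], so that the recurrence also
   holds at [n = 0]. *)
Definition lamp n := if n is m.+1 then lam m else 0.

Lemma lam_gt0 n : 0 < lam n.
Proof. by have [/(_ n)/andP[]] := lam_adm. Qed.

Lemma lam_lt1 n : lam n < 1.
Proof. by have [/(_ n)/andP[]] := lam_adm. Qed.

Lemma lam_neq0 n : lam n != 0. Proof. by rewrite gt_eqF ?lam_gt0. Qed.

Lemma lamp_ge0 n : 0 <= lamp n.
Proof. by case: n => //= n; exact/ltW/lam_gt0. Qed.

Lemma lam_even_odd n : lam n.*2 + lam n.*2.+1 <= lam n.*2.+2.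
Proof.
have [_ _ /(_ n.+1 isT)[+ _]] := lam_adm.
by rewrite mulnS mul2n add2n !subSS subn0.
Qed.

Lemma lam_odd_even n : lam n.*2.+1 + lam n.*2.+2 <= lam n.*2.+4.
Proof.
have [_ _ /(_ n.+1 isT)[_ +]] := lam_adm.
by rewrite mulnS mul2n add2n addn2 !subSS subn0.
Qed.

Lemma lam_even_cvg : lam n.*2 @[n --> \oo] --> (1 : R).
Proof.
have [_ + _] := lam_adm.
by under eq_fun => n do rewrite mul2n.
Qed.

Lemma lam_even_le m n : (m <= n)%N -> lam m.*2 <= lam n.*2.
Proof.
move=> /subnK <-; elim: (n - m)%N => [//|k IH]; rewrite addSn doubleS.
apply: (le_trans IH); apply: le_trans (lam_even_odd _).
by rewrite lerDl ltW ?lam_gt0.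
Qed.

Lemma lamp_even_gap m n : (m < n)%N -> lam m.*2 + lamp m.*2 <= lam n.*2.
Proof.
case: m => [|m] mn; first by rewrite addr0 lam_even_le.
rewrite addrC /= ?doubleS.
by apply: (le_trans (lam_odd_even m)); rewrite -!doubleS lam_even_le.
Qed.

Lemma lamp_even_le n :
  lamp n.*2 * lamp n.*2.-1 + lamp n.*2 ^+ 2 <= lam n.*2 * lamp n.*2.
Proof.
case: n => [|n]; first by rewrite /= !mulr0 expr0n addr0.
rewrite doubleS /= expr2 -mulrDr mulrC ler_wpM2r ?(ltW (lam_gt0 _)) //.
exact: lam_even_odd.
Qed.

(** These are the row sums of J; their being below 1 is what makes Q_n(1) increase. *)
Lemma lam_sum_lt1 n : lamp n + lam n < 1.
Proof.
case: n => [|n]; first by rewrite add0r lam_lt1.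
rewrite /= -[n]odd_double_half; case: (odd n) => /=.
  by rewrite add1n; apply: le_lt_trans (lam_odd_even _) (lam_lt1 _).
by rewrite add0n; apply: le_lt_trans (lam_even_odd _) (lam_lt1 _).
Qed.

Lemma mulX_Q n : 'X * Q n = lam n *: Q n.+1 + lamp n *: Q n.-1.
Proof.
case: n => [|n]; last exact: (Qpoly_recurrence lam_neq0).
by rewrite /= scalerA mulfV ?lam_neq0 // scale1r scale0r addr0 mulr1.
Qed.

(** Row [n] of J^2. For [n < 2] the truncated index [n.-2] is harmless, because [lamp 0 = 0]
    annihilates its coefficient. *)
Lemma mulXX_Q n : 'X * ('X * Q n) = (lam n * lam n.+1) *: Q n.+2
  + (lam n ^+ 2 + lamp n ^+ 2) *: Q n + (lamp n * lamp n.-1) *: Q n.-2.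
Proof.
move: Q mulX_Q => F mulXF.
rewrite mulXF mulrDr -!scalerAr !mulXF !scalerDr !scalerA -!mul_polyC.
by case: n => [|[|n]] /=; rewrite !(polyCD, expr2, polyCM, polyC0); ring.
Qed.

End Admissible.

(** * Degrees, values at 1 and the normalized recurrence *)

Section Values.
Context {R : realType} (lam : nat -> R) (lam_adm : admissible lam).
Local Notation Q := (Qpoly lam).
Local Notation P := (Ppoly lam).
Local Notation lamp := (lamp lam).

Lemma Qpoly_size_lead n : size (Q n) = n.+1 /\ 0 < lead_coef (Q n).
Proof.
have lamV_gt0 k : 0 < (lam k)^-1 by rewrite invr_gt0 lam_gt0.
have lamV_neq0 k : (lam k)^-1 != 0 by rewrite gt_eqF.
suff [] : (size (Q n) = n.+1 /\ 0 < lead_coef (Q n)) /\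
          (size (Q n.+1) = n.+2 /\ 0 < lead_coef (Q n.+1)) by [].
elim: n => [|n [[s0 l0] [s1 l1]]]; split=> //.
- by rewrite size_poly1 lead_coef1 ltr01.
- by rewrite /= size_scale // size_polyX lead_coefZ lead_coefX mulr1.
have Q1 : Q n.+1 != 0 by rewrite -size_poly_eq0 s1.
have -> : Q n.+2 = (lam n.+1)^-1 *: ('X * Q n.+1 - lam n *: Q n) by [].
have sX : size ('X * Q n.+1) = n.+3 by rewrite mulrC size_mulX // s1.
have lt_size : (size (- (lam n *: Q n)) < size ('X * Q n.+1)%R)%N.
  by rewrite sX size_polyN size_scale ?lam_neq0 // s0.
rewrite size_scale // size_polyDl // lead_coefZ lead_coefDl // sX.
by rewrite mulrC mulr_gt0 // mulrC lead_coefMX.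
Qed.

Lemma size_Qpoly n : size (Q n) = n.+1.
Proof. by have [] := Qpoly_size_lead n. Qed.

Lemma lead_coef_Qpoly_gt0 n : 0 < lead_coef (Q n).
Proof. by have [] := Qpoly_size_lead n. Qed.

Lemma mulx_Q n x :
  x * (Q n).[x] = lam n * (Q n.+1).[x] + lamp n * (Q n.-1).[x].
Proof.
by have := congr1 (horner^~ x) (mulX_Q lam_adm n); rewrite !(hornerE, hornerM).
Qed.

Lemma mulxx_Q n x : x ^+ 2 * (Q n).[x] = lam n * lam n.+1 * (Q n.+2).[x]
  + (lam n ^+ 2 + lamp n ^+ 2) * (Q n).[x] + lamp n * lamp n.-1 * (Q n.-2).[x].
Proof.
have := congr1 (horner^~ x) (mulXX_Q lam_adm n).
by rewrite !(hornerD, hornerZ, hornerM, hornerX) mulrA -expr2.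
Qed.

Lemma Q0_horner x : (Q 0).[x] = 1. Proof. by rewrite hornerC. Qed.

Lemma Q_at1 n : 0 < (Q n).[1] < (Q n.+1).[1].
Proof.
elim: n => [|n /andP[qn0 qn1]].
  rewrite Q0_horner ltr01 /= -(ltr_pM2l (lam_gt0 lam_adm 0)).
  have := mulx_Q 0 1; rewrite Q0_horner mul0r addr0 mulr1 => <-.
  by rewrite mulr1 lam_lt1.
have qS0 := lt_trans qn0 qn1; rewrite qS0 /=.
rewrite -(ltr_pM2l (lam_gt0 lam_adm n.+1)).
have -> : lam n.+1 * (Q n.+2).[1] = (Q n.+1).[1] - lam n * (Q n).[1].
  by apply/eqP; rewrite eq_sym subr_eq -{1}[(Q n.+1).[1]]mul1r (mulx_Q n.+1).
rewrite ltrBrDr.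
have h1 : lam n * (Q n).[1] < lam n * (Q n.+1).[1].
  by rewrite ltr_pM2l ?lam_gt0.
have h2 : (lam n + lam n.+1) * (Q n.+1).[1] < 1 * (Q n.+1).[1].
  by rewrite ltr_pM2r //; exact: (lam_sum_lt1 lam_adm n.+1).
lra.
Qed.

Lemma Q_at1_gt0 n : 0 < (Q n).[1]. Proof. by have /andP[] := Q_at1 n. Qed.

Lemma Q_at1_neq0 n : (Q n).[1] != 0. Proof. by rewrite gt_eqF ?Q_at1_gt0. Qed.

Lemma Q_P n : Q n = (Q n).[1] *: P n.
Proof. by rewrite /Ppoly scalerA mulfV ?Q_at1_neq0 // scale1r. Qed.

Lemma horner_P n x : (P n).[x] = (Q n).[x] / (Q n).[1].
Proof. by rewrite /Ppoly hornerZ mulrC. Qed.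

Lemma size_Ppoly n : size (P n) = n.+1.
Proof. by rewrite size_scale ?invr_eq0 ?Q_at1_neq0 // size_Qpoly. Qed.

Lemma Ppoly_at1 n : (P n).[1] = 1.
Proof. by rewrite horner_P mulfV ?Q_at1_neq0. Qed.

Lemma Ppoly0 : P 0 = 1.
Proof. by rewrite /Ppoly Q0_horner invr1 scale1r. Qed.

Lemma Ppoly1 : P 1 = 'X.
Proof.
rewrite /Ppoly /= hornerZ hornerX mulr1 invrK scalerA mulfV ?scale1r //.
exact: lam_neq0.
Qed.

Lemma Ppoly_normalized : normalized_recurrence P.
Proof.
split; [exact: Ppoly0|exact: Ppoly1|].
(* Dividing the recurrence by Q_n(1) produces this coefficient; the other one is [1 - c n] because
   the recurrence also holds at the point 1. *)
exists (fun n => lamp n * (Q n.-1).[1] / (Q n).[1]) => -[//|n] _.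
rewrite -[lamp n.+1]/(lam n) -[n.+1.-1]/n.
have [[qn qS] qSS] := (Q_at1_gt0 n, Q_at1_gt0 n.+1, Q_at1_gt0 n.+2).
have := mulx_Q n.+1 1; rewrite mul1r -[lamp n.+1]/(lam n) -[n.+1.-1]/n => E.
split.
- by rewrite !mulr_gt0 ?invr_gt0 ?lam_gt0.
- by rewrite ltr_pdivrMr // mul1r E ltrDr mulr_gt0 ?lam_gt0.
have XQ := mulX_Q lam_adm n.+1; rewrite /Ppoly.
move: (Q) XQ qn qS qSS E => F XF qn qS qSS E.
rewrite -scalerAr XF scalerDr !scalerA -[lamp n.+1]/(lam n) -[n.+1.-1]/n.
congr (_ *: _ + _ *: _); last by field; rewrite !gt_eqF.
have -> : 1 - lam n * (F n).[1] / (F n.+1).[1] =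
  lam n.+1 * (F n.+2).[1] / (F n.+1).[1].
  by apply: (mulIf (lt0r_neq0 qS)); rewrite mulrBl !mulfVK ?gt_eqF // mul1r {1}E; ring.
by field; rewrite !gt_eqF.
Qed.

End Values.

(** * Nonnegative linearization and the Haar function *)

Section Linearization.
Context {R : realType} (lam : nat -> R) (lam_adm : admissible lam).
Local Notation Q := (Qpoly lam).
Local Notation P := (Ppoly lam).
Local Notation lamp := (lamp lam).
Local Notation K := (cone P).

Lemma cone_Q n : K (Q n).
Proof.
by rewrite (Q_P lam_adm) -/(Ppoly _ _); apply/coneZ/cone_gen/ltW/Q_at1_gt0.
Qed.

Lemma coneZ_inv a p : 0 < a -> K (a *: p) -> K p.
Proof.
move=> a0 /(coneZ (a := a^-1)); rewrite scalerA mulVf ?gt_eqF // scale1r.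
by apply; rewrite invr_ge0 ltW.
Qed.

Lemma coneXQ p j : (forall i, (j <= i.+1)%N -> K (p * Q i)) ->
  K (p * ('X * Q j)).
Proof.
move=> Kp; rewrite (mulX_Q lam_adm) mulrDr -!scalerAr.
apply: coneD; apply: coneZ; rewrite ?lamp_ge0 ?(ltW (lam_gt0 _ _)) //.
  by apply: Kp; rewrite leqW.
by apply: Kp; case: j => //.
Qed.

Lemma lam_sqr_ge n j : (n.*2.+2 <= j)%N ->
  lam n.*2.+2 ^+ 2 <= lam j ^+ 2 + lamp j ^+ 2.
Proof.
move=> nj; rewrite -[j]odd_double_half in nj *.
have [l0 l1] := (lam_gt0 lam_adm n.*2.+2, lam_gt0 lam_adm (j./2).*2).
have nj2 : lam n.*2.+2 <= lam (j./2).*2.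
  by rewrite -doubleS lam_even_le //; case: (odd j) nj => /=; lia.
have le_sq : lam n.*2.+2 ^+ 2 <= lam (j./2).*2 ^+ 2.
  by rewrite ler_pXn2r // nnegrE ltW.
case: (odd j); rewrite ?add1n ?add0n /=.
  by apply: (le_trans le_sq); rewrite lerDr sqr_ge0.
by apply: (le_trans le_sq); rewrite lerDl sqr_ge0.
Qed.

(** With e, o, p, f as in the proof, [lamp_even_le] bounds the left side by e (e + p) + o (e + o) <=
    (e + o) f <= f^2. This gap between diagonal entries of J^2 keeps the coefficient of Q_(2n) Q_j
    in [cone_even_step] nonnegative. *)
Lemma lam_gap n : lamp n.*2 * lamp n.*2.-1 + lam n.*2 ^+ 2 + lamp n.*2 ^+ 2
   + lam n.*2.+1 * (lam n.*2 + lam n.*2.+1) <= lam n.*2.+2 ^+ 2.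
Proof.
have h1 := lamp_even_le lam_adm n; have h2 := lam_even_odd lam_adm n.
have h3 : lam n.*2 + lamp n.*2 <= lam n.*2.+2.
  by rewrite -doubleS lamp_even_gap.
have e0 := lam_gt0 lam_adm n.*2; have o0 := lam_gt0 lam_adm n.*2.+1.
have p0 := lamp_ge0 lam_adm n.*2.
set e := lam n.*2 in h1 h2 h3 e0 *; set o := lam n.*2.+1 in h2 o0 *.
set p := lamp n.*2 in h1 h3 p0 *; set f := lam n.*2.+2 in h2 h3 *.
have : 0 <= (f - e - o) * (e + o) by rewrite mulr_ge0 //; lra.
have : 0 <= (f - e - p) * e by rewrite mulr_ge0 //; lra.
have : 0 <= (f - e - o) * (f - e) by rewrite mulr_ge0 //; lra.
lra.
Qed.

(* Monotonicity in [n] needs only the coefficient [lam n.*2] of [Q n.*2]; the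
   surplus [lam n.*2.+1] pays for the odd indices in [cone_odd]. *)
Lemma cone_even_step n j : (n.*2.+2 <= j)%N ->
  (forall i, (n.*2 <= i)%N -> K (Q n.*2 * Q i)) ->
  (forall i, (n.*2 <= i)%N -> K (lamp n.*2 *: ((Q n.*2 - Q n.*2.-2) * Q i))) ->
  K ((lam n.*2 *: Q n.*2.+2 - (lam n.*2 + lam n.*2.+1) *: Q n.*2) * Q j).
Proof.
move=> nj K1 K2; apply: (coneZ_inv (lam_gt0 lam_adm n.*2.+1)).
(* Expand X^2 Q_(2n) Q_j in two ways, applying X^2 to either factor, and solve for Q_(2n+2) Q_j. The
   term with Q_(2n-2) enters with the wrong sign and is absorbed into the difference Q_(2n) -
   Q_(2n-2). *)
have -> : lam n.*2.+1 *:
    ((lam n.*2 *: Q n.*2.+2 - (lam n.*2 + lam n.*2.+1) *: Q n.*2) * Q j) =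
  (lam j * lam j.+1) *: (Q n.*2 * Q j.+2) +
  (lamp j * lamp j.-1) *: (Q n.*2 * Q j.-2) +
  (lam j ^+ 2 + lamp j ^+ 2 - lam n.*2 ^+ 2 - lamp n.*2 ^+ 2
   - lamp n.*2 * lamp n.*2.-1 - lam n.*2.+1 * (lam n.*2 + lam n.*2.+1)) *:
    (Q n.*2 * Q j) +
  lamp n.*2.-1 *: (lamp n.*2 *: ((Q n.*2 - Q n.*2.-2) * Q j)).
  have : 'X * ('X * Q n.*2) * Q j = Q n.*2 * ('X * ('X * Q j)) by ring.
  rewrite !(mulXX_Q lam_adm) => /eqP; rewrite -subr_eq0 => /eqP E.
  apply/eqP; rewrite -subr_eq0 -E -!mul_polyC; apply/eqP.
  move: (Q) E => F _.
  by rewrite !(polyCB, polyCD, polyCM, expr2); ring.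
apply: coneD; [apply: coneD; [apply: coneD|]|]; apply: coneZ.
- by rewrite mulr_ge0 // ltW ?lam_gt0.
- by apply: K1; lia.
- by rewrite mulr_ge0 ?lamp_ge0.
- by apply: K1; lia.
- by have := lam_gap n; have := lam_sqr_ge nj; lra.
- by apply: K1; lia.
- exact: lamp_ge0.
- by apply: K2; lia.
Qed.

(** Positivity and monotonicity are proved together because [cone_even_step] consumes both. *)
Lemma cone_even n : (forall i, (n.*2 <= i)%N -> K (Q n.*2 * Q i)) /\
  (forall i, (n.*2 <= i)%N -> K (lamp n.*2 *: ((Q n.*2 - Q n.*2.-2) * Q i))).
Proof.
elim: n => [|n [K1 K2]].
  split=> i _; last by rewrite scale0r; exact: cone0.
  by rewrite mul1r; exact: cone_Q.
have e0 := lam_gt0 lam_adm n.*2; have o0 := lam_gt0 lam_adm n.*2.+1.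
rewrite doubleS; split=> i ni; have KS := cone_even_step ni K1 K2.
  apply: (coneZ_inv e0).
  have -> : lam n.*2 *: (Q n.*2.+2 * Q i) =
    (lam n.*2 *: Q n.*2.+2 - (lam n.*2 + lam n.*2.+1) *: Q n.*2) * Q i +
    (lam n.*2 + lam n.*2.+1) *: (Q n.*2 * Q i).
    by rewrite mulrBl -!scalerAl subrK.
  by apply/(coneD KS)/coneZ/K1; [rewrite addr_ge0 // ltW|lia].
apply: coneZ; first exact: ltW.
apply: (coneZ_inv e0).
have -> : lam n.*2 *: ((Q n.*2.+2 - Q n.*2.+2.-2) * Q i) =
  (lam n.*2 *: Q n.*2.+2 - (lam n.*2 + lam n.*2.+1) *: Q n.*2) * Q i +
  lam n.*2.+1 *: (Q n.*2 * Q i).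
  by rewrite scalerDl -[n.*2.+2.-2]/(n.*2); move: (Q) => F; rewrite -!mul_polyC; ring.
by apply/(coneD KS)/coneZ/K1; [exact: ltW|lia].
Qed.

(** Eliminating Q_(2n+1) from the recurrences for X Q_(2n+2) and X Q_(2n) writes Q_(2n+3) as X times
    an even combination plus a positive multiple of Q_(2n-1). The factor X is then moved to Q_i. The
    second claim carries Q_(2n-1) along; [lamp 0 = 0] settles its start. *)
Lemma cone_odd n : (forall i, (n.*2.+1 <= i)%N -> K (Q n.*2.+1 * Q i)) /\
  (forall i, (n.*2.+1 <= i)%N -> K (lamp n.*2 *: (Q n.*2.-1 * Q i))).
Proof.
elim: n => [|n [K1 K2]].
  split=> i ni; last by rewrite scale0r; exact: cone0.
  apply: (coneZ_inv (lam_gt0 lam_adm 0)).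
  have -> : lam 0 *: (Q 1 * Q i) = 1 * ('X * Q i).
    by rewrite scalerAl; have := mulX_Q lam_adm 0; rewrite scale0r addr0 => <-; ring.
  by apply: coneXQ => j _; rewrite mul1r; exact: cone_Q.
have e0 := lam_gt0 lam_adm n.*2; have f0 := lam_gt0 lam_adm n.*2.+2.
have o0 := lam_gt0 lam_adm n.*2.+1.
rewrite doubleS; split=> i ni; last first.
  by apply: coneZ; [exact: ltW|apply: K1; lia].
apply: (coneZ_inv e0); apply: (coneZ_inv f0).
have -> : lam n.*2.+2 *: (lam n.*2 *: (Q n.*2.+3 * Q i)) =
  (lam n.*2 *: Q n.*2.+2 - lam n.*2.+1 *: Q n.*2) * ('X * Q i)
  + lam n.*2.+1 *: (lamp n.*2 *: (Q n.*2.-1 * Q i)).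
  have := mulX_Q lam_adm n.*2; have := mulX_Q lam_adm n.*2.+2.
  move: (Q) => F /= E1 E2; rewrite -!mul_polyC in E1 E2 *.
  have -> : ((lam n.*2)%:P * F n.*2.+2 - (lam n.*2.+1)%:P * F n.*2) * ('X * F i)
    = ((lam n.*2)%:P * ('X * F n.*2.+2) - (lam n.*2.+1)%:P * ('X * F n.*2)) * F i.
    by ring.
  by rewrite E1 E2; ring.
apply: coneD; last by apply: coneZ; [exact: ltW|apply: K2; lia].
apply: coneXQ => j ij.
have [Ke1 Ke2] := cone_even n.
have -> : (lam n.*2 *: Q n.*2.+2 - lam n.*2.+1 *: Q n.*2) * Q j =
  (lam n.*2 *: Q n.*2.+2 - (lam n.*2 + lam n.*2.+1) *: Q n.*2) * Q j
  + lam n.*2 *: (Q n.*2 * Q j).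
  by rewrite scalerDl; move: (Q) => F; rewrite -!mul_polyC; ring.
apply: coneD; first by apply: cone_even_step => //; lia.
by apply: coneZ; [exact: ltW|apply: Ke1; lia].
Qed.

Lemma cone_QQ m n : K (Q m * Q n).
Proof.
wlog mn : m n / (m <= n)%N.
  by move=> H; case: (leqP m n) => [/H//|/ltnW/H]; rewrite mulrC.
rewrite -[m]odd_double_half in mn *; case: (odd m) mn => mn.
  by have [+ _] := cone_odd m./2; apply.
by have [+ _] := cone_even m./2; apply.
Qed.

Lemma cone_PP m n : K (P m * P n).
Proof.
rewrite /Ppoly -scalerAl -scalerAr; do 2![apply: coneZ; first
  by rewrite invr_ge0 ltW // Q_at1_gt0].
exact: cone_QQ.
Qed.

Lemma Ppoly_nonneg_linearization : nonneg_linearization P.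
Proof.
move=> m n; have [c c0 /(lin_coefP (size_Ppoly lam_adm))[lin E]] := cone_PP m n.
by rewrite E; split.
Qed.

(** Orthonormality in algebraic form: the coefficient at Q_0 plays the role of the integral. It
    determines [haar] without reference to a measure. *)
Lemma combination_QQ (m n : nat) : exists2 c : {poly R},
  c`_0 = (m == n)%:R & Q m * Q n = combination Q c.
Proof.
suff [] : (forall n, exists2 c : {poly R},
    c`_0 = (m == n)%:R & Q m * Q n = combination Q c) /\
  (forall n, exists2 c : {poly R},
    c`_0 = (m.+1 == n)%:R & Q m.+1 * Q n = combination Q c) by [].
have XQ k p i : (forall n, exists2 c : {poly R},
    c`_0 = (k == n)%:R & p * Q n = combination Q c) ->
  exists2 c : {poly R}, c`_0 = lam i * (k == i.+1)%:R + lamp i * (k == i.-1)%:R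
    & p * ('X * Q i) = combination Q c.
  move=> H; have [[c c0 cE] [d d0 dE]] := (H i.+1, H i.-1).
  exists (lam i *: c + lamp i *: d); first by rewrite coefD !coefZ c0 d0.
  by rewrite combinationD !combinationZ -cE -dE (mulX_Q lam_adm) mulrDr -!scalerAr.
have Q0n k : exists2 c : {poly R}, c`_0 = (0 == k)%:R & Q 0 * Q k = combination Q c.
  by exists 'X^k; [rewrite coefXn|rewrite combinationXn mul1r].
elim: m => [|m [IH0 IH1]]; split=> // {}n.
  have [c c0 cE] := XQ 0 (Q 0) n Q0n.
  exists ((lam 0)^-1 *: c).
    rewrite coefZ c0 -[0 == n.+1]/false mulr0 add0r.
    case: n {c0 cE} => [|[|n]] /=; rewrite ?mul0r ?mulr0 //.
    by rewrite mulr1 mulVf ?lam_neq0.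
  rewrite combinationZ -cE mul1r -[Q 1]/((lam 0)^-1 *: 'X).
  by rewrite -scalerAl.
have [[c c0 cE] [d d0 dE]] := (XQ m.+1 (Q m.+1) n IH1, IH0 n).
exists ((lam m.+1)^-1 *: (c - lam m *: d)).
  rewrite coefZ coefB coefZ c0 d0; have l0 := lam_neq0 lam_adm m.+1.
  case: n {c0 d0 cE dE} => [|n] /=.
    by rewrite !eqSS mul0r; case: (m) => [|k] /=; rewrite ?(mulr1, mulr0, addr0, subrr).
  rewrite !eqSS; have [mn|mn] := eqVneq m n.+1.
    have -> : (m.+1 == n) = false by lia.
    by rewrite mn !mulr0 mulr1 addr0 subrr mulr0.
  rewrite !mulr0 add0r subr0; case: eqP => [nE|]; last by rewrite !mulr0.
  by rewrite -nE mulr1 mulVf.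
have -> : Q m.+2 = (lam m.+1)^-1 *: ('X * Q m.+1 - lam m *: Q m) by [].
rewrite combinationZ combinationB combinationZ -cE -dE.
by rewrite -scalerAl mulrBl -scalerAl mulrCA -mulrA.
Qed.

Lemma haarE n : haar P n = (Q n).[1] ^+ 2.
Proof.
have [c c0 cE] := combination_QQ n n; rewrite eqxx in c0.
(* Replacing each Q_k by Q_k(1) P_k rescales the k-th coefficient by Q_k(1), which is 1 at k = 0. *)
pose d := ((Q n).[1] ^- 2) *: \poly_(k < size c) (c`_k * (Q k).[1]).
have PP : P n * P n = combination P d.
  rewrite combinationZ /Ppoly -scalerAl -scalerAr scalerA -invfM -expr2 cE.
  congr (_ *: _); rewrite [RHS](@combination_widen _ _ _ (size c)) ?size_poly //.
  apply: eq_bigr => i _; rewrite coef_poly ltn_ord -scalerA.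
  by rewrite [X in _ *: X = _](Q_P lam_adm).
have [_ E] := lin_coefP (size_Ppoly lam_adm) PP.
rewrite /haar E coefZ coef_poly.
have -> : (0 < size c)%N.
  rewrite lt0n size_poly_eq0; apply: contra_eqN c0 => /eqP ->.
  by rewrite coef0 eq_sym oner_eq0.
by rewrite c0 mul1r Q0_horner mulr1 invrK.
Qed.

End Linearization.

(** * Growth of Q_n at 1 and decay on the dual space *)

Section Growth.
Context {R : realType} (lam : nat -> R) (lam_adm : admissible lam).
Local Notation Q := (Qpoly lam).
Local Notation P := (Ppoly lam).
Local Notation lamp := (lamp lam).

Lemma Q_at1_le m n : (m <= n)%N -> (Q m).[1] <= (Q n).[1].
Proof.
move=> /subnK <-; elim: (n - m)%N => [//|k IH]; rewrite addSn.
by apply: (le_trans IH); have /andP[_ /ltW] := Q_at1 lam_adm (k + m).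
Qed.

(** The factor 2 yields the bound 4 and the exponential growth of the Haar function, and later
    excludes atoms at 1 and -1. *)
Lemma Q_at1_double n : 2 * (Q n.*2).[1] < (Q n.*2.+2).[1].
Proof.
have e0 := lam_gt0 lam_adm n.*2; have o0 := lam_gt0 lam_adm n.*2.+1.
have e1 := lam_lt1 lam_adm n.*2; have g1 := lam_lt1 lam_adm n.*2.+4.
have f1 := lam_lt1 lam_adm n.*2.+2.
have h1 := lamp_even_le lam_adm n; have h2 := lam_even_odd lam_adm n.
have h3 : lam n.*2 + lamp n.*2 <= lam n.*2.+2.
  by rewrite -doubleS lamp_even_gap.
have h4 := lam_odd_even lam_adm n.
have q0 := Q_at1_gt0 lam_adm n.*2.
have h5 : (lamp n.*2 * lamp n.*2.-1) * (Q n.*2.-2).[1] <=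
   (lamp n.*2 * lamp n.*2.-1) * (Q n.*2).[1].
  by rewrite ler_wpM2l ?mulr_ge0 ?lamp_ge0 // Q_at1_le //; lia.
have := mulxx_Q lam_adm n.*2 1; rewrite expr1n mul1r => E.
rewrite -(ltr_pM2l (mulr_gt0 e0 o0)).
move: (lam n.*2) (lam n.*2.+1) (lam n.*2.+2) (lam n.*2.+4) (lamp n.*2)
  (lamp n.*2.-1) (Q n.*2.+2).[1] (Q n.*2).[1] (Q n.*2.-2).[1]
  e0 o0 e1 g1 f1 h1 h2 h3 h4 q0 h5 E => e o f g p p' q2 q q' e0 o0 e1 g1 f1
  h1 h2 h3 h4 q0 h5 E.
(* Indeed e (e + p + 2 o) <= e (f + 2 o) < e (1 + o) < e (2 - e) < 1. *)
have h6 : e * p + 2 * (e * o) < 1 - e ^+ 2.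
  have k1 : 0 <= (f - e - p) * e by rewrite mulr_ge0 //; lra.
  have k2 : 0 <= (f - e - o) * e by rewrite mulr_ge0 //; lra.
  have k3 : 0 < (1 - f - o) * e by rewrite mulr_gt0 //; lra.
  have k4 : 0 <= (1 - f) * e by rewrite mulr_ge0 //; lra.
  have k5 : 0 < (1 - e) ^+ 2 by rewrite exprn_gt0 //; lra.
  lra.
have h7 : (e * p + 2 * (e * o)) * q < (1 - e ^+ 2) * q by rewrite ltr_pM2r.
have h8 : (p * p' + p ^+ 2) * q <= (e * p) * q by rewrite ler_wpM2r // ltW.
lra.
Qed.

Lemma Q_at1_expr n : 2 ^+ n <= (Q n.*2).[1].
Proof.
elim: n => [|n IH]; first by rewrite expr0 Q0_horner.
rewrite doubleS exprS; apply: le_trans (ltW (Q_at1_double n)).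
by rewrite ler_pM2l.
Qed.

Lemma haar_gt4 n : (2 <= n)%N -> 4 < haar P n.
Proof.
move=> n2; rewrite (haarE lam_adm).
have h : 2 < (Q n).[1].
  have := Q_at1_double 0; rewrite Q0_horner mulr1 => /lt_le_trans; apply.
  exact: Q_at1_le.
have -> : (4 : R) = 2 ^+ 2 by ring.
by rewrite ltr_pXn2r // nnegrE ltW // (lt_trans _ h).
Qed.

Lemma haar_incr : strictly_increasing (haar P).
Proof.
move=> n; rewrite !(haarE lam_adm); have /andP[q0 q1] := Q_at1 lam_adm n.
by rewrite ltr_pXn2r // nnegrE ltW // (lt_trans q0 q1).
Qed.

(** Squaring the bound 2^(n/2), with integer division, loses a factor 2 when n is odd; hence the
    constant 1/2. *)
Lemma haar_expr n : 2^-1 * 2 ^+ n <= haar P n.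
Proof.
rewrite (haarE lam_adm).
have h : 2 ^+ n./2 <= (Q n).[1].
  by apply: (le_trans (Q_at1_expr _)); apply: Q_at1_le; lia.
apply: (@le_trans _ _ ((2 ^+ n./2) ^+ 2)); last first.
  by rewrite ler_pXn2r // nnegrE ?exprn_ge0 // ltW // Q_at1_gt0.
rewrite -exprM -{1}[n]odd_double_half exprD mulrA muln2 ler_piMl ?exprn_ge0 //.
by case: (odd n); rewrite ?expr1 ?expr0; lra.
Qed.

Lemma Q_opp n x : (Q n).[- x] = (-1) ^+ n * (Q n).[x].
Proof.
have l0 := lam_neq0 lam_adm.
suff [] : (Q n).[- x] = (-1) ^+ n * (Q n).[x] /\
          (Q n.+1).[- x] = (-1) ^+ n.+1 * (Q n.+1).[x] by [].
elim: n => [|n [IH0 IH1]].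
  split; first by rewrite !Q0_horner expr0 mulr1.
  by rewrite /= !hornerZ !hornerX expr1; ring.
split=> //; apply: (mulfI (l0 n.+1)).
have := mulx_Q lam_adm n.+1 x; have := mulx_Q lam_adm n.+1 (- x).
rewrite IH1 [lamp _]/= [n.+1.-1]/= IH0.
move: (Q n.+2).[- x] (Q n.+2).[x] (Q n.+1).[x] (Q n).[x] => a b c d E1 E2.
have -> : lam n.+1 * a = - x * ((-1) ^+ n.+1 * c) - lam n * ((-1) ^+ n * d).
  by rewrite E1; ring.
have -> : lam n.+1 * ((-1) ^+ n.+2 * b) = (-1) ^+ n.+2 * (x * c - lam n * d).
  by rewrite E2; ring.
by rewrite !exprS; ring.
Qed.

Lemma dual_space_P x : dual_space P x <-> forall n, `|(P n).[x]| <= 1.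
Proof.
split=> [[_ //]|Px]; split=> //.
by exists 0; rewrite Ppoly0 hornerC normr1.
Qed.

Lemma dual_space_Q x : dual_space P x <-> forall n, `|(Q n).[x]| <= (Q n).[1].
Proof.
rewrite dual_space_P; split=> H n; have := H n; have q := Q_at1_gt0 lam_adm n;
  by rewrite horner_P normrM normfV (gtr0_norm q) ler_pdivrMr // mul1r.
Qed.

Lemma dual_space_opp x : dual_space P x -> dual_space P (- x).
Proof.
move=> /dual_space_Q H; apply/dual_space_Q => n.
by rewrite Q_opp normrM normrX normrN1 expr1n mul1r.
Qed.

Lemma dual_space_le1 x : dual_space P x -> `|x| <= 1.
Proof. by move=> /dual_space_P /(_ 1); rewrite (Ppoly1 lam_adm) hornerX. Qed.

(* This is the inequality [-1 <= P 2]. *)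
Lemma dual_space_sqr x : dual_space P x -> 2 * lam 0 ^+ 2 - 1 <= x ^+ 2.
Proof.
move=> /dual_space_Q /(_ 2); rewrite ler_norml => /andP[+ _].
have [l0 l1] := (lam_gt0 lam_adm 0, lam_gt0 lam_adm 1).
have l01 := mulr_gt0 l0 l1.
rewrite -(ler_pM2l l01).
have := mulxx_Q lam_adm 0 x; have := mulxx_Q lam_adm 0 1.
rewrite !Q0_horner; move: (Q 2).[x] (Q 2).[1] => a b /=; lra.
Qed.

(** The coefficient x^2 - e^2 - p^2 of Q_(2n)(x) has absolute value at least 6 t, and the term with
    Q_(2n-2)(x) costs at most 2 t |Q_(2n)(x)|, since p <= t. The remaining 4 t beats the 2 t of
    [even_growth1] by a factor 2. *)
Lemma even_growth t n x : 1 - lam n.*2 <= t -> x ^+ 2 + 8 * t <= 1 ->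
  `|(Q n.*2.-2).[x]| <= 2 * `|(Q n.*2).[x]| ->
  4 * t * `|(Q n.*2).[x]| <= lam n.*2 * lam n.*2.+1 * `|(Q n.*2.+2).[x]|.
Proof.
move=> et xt le2.
have e0 := lam_gt0 lam_adm n.*2; have o0 := lam_gt0 lam_adm n.*2.+1.
have e1 := lam_lt1 lam_adm n.*2; have f1 := lam_lt1 lam_adm n.*2.+2.
have h3 : lam n.*2 + lamp n.*2 <= lam n.*2.+2.
  by rewrite -doubleS lamp_even_gap.
have p0 := lamp_ge0 lam_adm n.*2; have p'0 := lamp_ge0 lam_adm n.*2.-1.
have p'1 : lamp n.*2.-1 <= 1.
  by case: (n.*2.-1) => [|k] /=; rewrite ?ler01 // ltW ?lam_lt1.
have E := mulxx_Q lam_adm n.*2 x.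
have -> : lam n.*2 * lam n.*2.+1 * `|(Q n.*2.+2).[x]| =
  `|(x ^+ 2 - lam n.*2 ^+ 2 - lamp n.*2 ^+ 2) * (Q n.*2).[x]
    - lamp n.*2 * lamp n.*2.-1 * (Q n.*2.-2).[x]|.
  rewrite -[X in X * _](ger0_norm (ltW (mulr_gt0 e0 o0))) -normrM.
  by congr (`|_|); rewrite !mulrBl E; ring.
apply: le_trans (lerB_dist _ _); rewrite !normrM.
rewrite (ger0_norm p0) (ger0_norm p'0).
have a0 := normr_ge0 (Q n.*2).[x]; have b0 := normr_ge0 (Q n.*2.-2).[x].
move: `|(Q n.*2).[x]| `|(Q n.*2.-2).[x]| le2 a0 b0 => a b le2 a0 b0.
move: (lam n.*2) (lamp n.*2) (lamp n.*2.-1) (lam n.*2.+2)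
  et e0 e1 f1 h3 p0 p'0 p'1 {E} => e p p' f et e0 e1 f1 h3 p0 p'0 p'1.
have k1 : p * p' * b <= t * (2 * a).
  have pt : p <= t by lra.
  rewrite -mulrA ler_pM ?mulr_ge0 //.
  by apply: (le_trans _ le2); rewrite ler_piMl.
have k2 : 6 * t <= `|x ^+ 2 - e ^+ 2 - p ^+ 2|.
  rewrite ler_normr; apply/orP; right.
  have : 0 <= p ^+ 2 by exact: sqr_ge0.
  have : 0 <= (1 - e) ^+ 2 by exact: sqr_ge0.
  lra.
have k3 : 6 * t * a <= `|x ^+ 2 - e ^+ 2 - p ^+ 2| * a by rewrite ler_wpM2r.
lra.
Qed.

Lemma even_growth1 t n : 1 - lam n.*2 <= t ->
  lam n.*2 * lam n.*2.+1 * (Q n.*2.+2).[1] <= 2 * t * (Q n.*2).[1].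
Proof.
move=> et; have e0 := lam_gt0 lam_adm n.*2; have e1 := lam_lt1 lam_adm n.*2.
have q0 := Q_at1_gt0 lam_adm n.*2.
have pp : 0 <= lamp n.*2 * lamp n.*2.-1 * (Q n.*2.-2).[1].
  by rewrite !mulr_ge0 ?lamp_ge0 // ltW // Q_at1_gt0.
have p2 : 0 <= lamp n.*2 ^+ 2 * (Q n.*2).[1] by rewrite mulr_ge0 ?sqr_ge0 // ltW.
have h : (1 - lam n.*2 ^+ 2) * (Q n.*2).[1] <= 2 * t * (Q n.*2).[1].
  rewrite ler_wpM2r // ?(ltW q0) //.
  have : 0 <= (1 - lam n.*2) ^+ 2 by exact: sqr_ge0.
  lra.
have := mulxx_Q lam_adm n.*2 1; rewrite expr1n mul1r; lra.
Qed.

Lemma even_growth_ratio t n x : 0 < t -> 1 - lam n.*2 <= t ->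
  x ^+ 2 + 8 * t <= 1 -> `|(Q n.*2.-2).[x]| <= 2 * `|(Q n.*2).[x]| ->
  2 * (`|(Q n.*2).[x]| * (Q n.*2.+2).[1]) <= `|(Q n.*2.+2).[x]| * (Q n.*2).[1].
Proof.
move=> t0 et xt le2; have := even_growth1 et; have := even_growth et xt le2.
have q0 := Q_at1_gt0 lam_adm n.*2.
have A0 := mulr_gt0 (lam_gt0 lam_adm n.*2) (lam_gt0 lam_adm n.*2.+1).
have u0 := normr_ge0 (Q n.*2).[x].
move: (lam n.*2 * _) `|(Q n.*2).[x]| `|(Q n.*2.+2).[x]| (Q n.*2).[1]
  (Q n.*2.+2).[1] q0 A0 u0 => A u u' v v' v0 A0 u0 h1 h2.
have tA : 0 < 2 * t * A by rewrite !mulr_gt0.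
rewrite -(ler_pM2l tA).
have k1 : 4 * t * u * (2 * t * v) <= A * u' * (2 * t * v).
  by rewrite ler_wpM2r // ltW // !mulr_gt0.
have k2 : 4 * t * u * (A * v') <= 4 * t * u * (2 * t * v).
  by rewrite ler_wpM2l // !mulr_ge0 // ltW.
lra.
Qed.

Lemma exists_expr_gt (c M : R) : 1 < c -> exists k : nat, M < c ^+ k.
Proof.
move=> c1; have bernoulli k : 1 + k%:R * (c - 1) <= c ^+ k.
  elim: k => [|k IH]; first by rewrite mul0r addr0 expr0.
  have : 0 <= k%:R * (c - 1) ^+ 2 by rewrite mulr_ge0 ?sqr_ge0.
  have := ler_wpM2l (ltW (lt_trans ltr01 c1)) IH.
  by rewrite [c ^+ _.+1]exprS -natr1; lra.
exists (Num.truncn (M / (c - 1))).+1; apply: lt_le_trans (bernoulli _).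
have := truncnS_gt (M / (c - 1)); rewrite ltr_pdivrMr ?subr_gt0 //; lra.
Qed.

Lemma exists_expr2_gt (M : R) : exists k : nat, M < 2 ^+ k.
Proof. by apply: exists_expr_gt; rewrite ltr1n. Qed.

(* If the even subsequence ever fails to halve, the recurrence makes it grow
   faster than at 1, so that [P n] is unbounded at [x]. *)
Lemma dual_space_halving r : r < 1 -> exists N, forall n x, (N <= n)%N ->
  `|x| <= r -> dual_space P x -> 2 * `|(Q n.*2.+2).[x]| <= `|(Q n.*2).[x]|.
Proof.
move=> r1; pose t := (1 - `|r|) / 8.
have [r0|r0] := ltP r 0.
  by exists 0 => n x _ xr; have := normr_ge0 x; lra.
have t0 : 0 < t by rewrite /t ger0_norm // divr_gt0 // subr_gt0.
have [N _ HN] : \forall n \near \oo, 1 - lam n.*2 <= t.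
  have /cvgrPdist_le /(_ t t0) := lam_even_cvg lam_adm.
  by apply: filterS => n; apply: le_trans; exact: ler_norm.
exists N => n x Nn xr /dual_space_Q Dx; rewrite leNgt; apply/negP => lt2.
have xt : x ^+ 2 + 8 * t <= 1.
  rewrite /t [8 * _]mulrC divfK // ger0_norm // -real_normK ?num_real //.
  have : `|x| * `|x| <= 1 * `|x| by rewrite ler_wpM2r //; lra.
  by rewrite -expr2; lra.
pose u k := `|(Q (n + k).*2).[x]|; pose v k := (Q (n + k).*2).[1].
have v0 k : 0 < v k by exact: Q_at1_gt0.
have vS k : v k <= v k.+1 by apply: Q_at1_le; lia.
have step k : u k <= 2 * u k.+1 -> 2 * (u k.+1 * v k.+2) <= u k.+2 * v k.+1.
  rewrite /u /v !addnS [(n + k).+2.*2]doubleS => H.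
  by apply: (even_growth_ratio t0) => //; apply: HN => /=; lia.
(* The ratio u / v doubles at every step while v does not decrease, so the failure of halving
   persists and u eventually exceeds v. Ratios are kept cross-multiplied. *)
have H k : u k <= 2 * u k.+1 /\ 2 ^+ k * (u 1 * v k.+1) <= u k.+1 * v 1.
  elim: k => [|k [IH1 IH2]].
    by rewrite expr0 mul1r /u /= addn0 addn1 doubleS ltW.
  have S := step k IH1; split.
    have : 2 * (u k.+1 * v k.+1) <= 2 * (u k.+1 * v k.+2).
      by rewrite ler_wpM2l // ler_wpM2l ?normr_ge0.
    have : 0 <= u k.+1 * v k.+1 by rewrite mulr_ge0 ?normr_ge0 // ltW.
    by move=> h1 h2; rewrite -(ler_pM2r (v0 k.+1)); lra.
  rewrite -(ler_pM2r (v0 k.+1)).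
  have := ler_wpM2r (ltW (v0 k.+2)) IH2; rewrite exprS.
  have := ler_wpM2r (ltW (v0 1)) S; lra.
have u1 : 0 < u 1.
  by have := normr_ge0 (Q n.*2).[x]; rewrite /u addn1 doubleS; lra.
have [k kM] := exists_expr2_gt (v 1 / u 1).
have [_ Hk] := H k.
have : u k.+1 * v 1 <= v k.+1 * v 1 by rewrite ler_wpM2r ?Dx // ltW.
move: kM; rewrite ltr_pdivrMr // => kM.
have : v 1 * v k.+1 < 2 ^+ k * u 1 * v k.+1 by rewrite ltr_pM2r.
lra.
Qed.

(** The point of this form is that [N] and [B] serve all dual points with |x| <= r at once. *)
Lemma dual_space_decay r : r < 1 -> exists N B, 0 < B /\ forall k x,
  `|x| <= r -> dual_space P x -> `|(Q (N + k).*2).[x]| <= B / 2 ^+ k.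
Proof.
move=> /dual_space_halving[N HN]; exists N, (Q N.*2).[1].
split=> [|k x xr Dx]; first exact: Q_at1_gt0.
elim: k => [|k IH].
  by rewrite addn0 expr0 divr1; have /dual_space_Q := Dx; apply.
have := HN (N + k)%N x (leq_addr _ _) xr Dx; rewrite addnS doubleS.
rewrite ler_pdivlMr ?exprn_gt0 // in IH.
rewrite ler_pdivlMr ?exprn_gt0 // exprS => /(ler_wpM2r (exprn_ge0 k (ler0n _ 2))).
lra.
Qed.

(** At 0 the odd-index recurrence gives |Q_(2n+2)| / |Q_(2n)| = [lam n.*2 / lam n.*2.+1], which
    exceeds 1 once [lam n.*2 >= 1/2], against the halving. *)
Lemma dual_spaceN0 : ~ dual_space P 0.
Proof.
move=> D0; have [N HN] := dual_space_halving ltr01.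
have E n : lam n.*2.+1 * `|(Q n.*2.+2).[0]| = lam n.*2 * `|(Q n.*2).[0]|.
  have := mulx_Q lam_adm n.*2.+1 0.
  rewrite mul0r -[lamp _]/(lam n.*2) -[n.*2.+1.-1]/n.*2 => /eqP.
  rewrite eq_sym addr_eq0 => /eqP /(congr1 (fun z => `|z|)).
  rewrite normrN !normrM (gtr0_norm (lam_gt0 lam_adm n.*2)).
  by rewrite (gtr0_norm (lam_gt0 lam_adm n.*2.+1)).
have Q0 n : 0 < `|(Q n.*2).[0]|.
  elim: n => [|n IH]; first by rewrite Q0_horner normr1.
  rewrite doubleS -(pmulr_rgt0 _ (lam_gt0 lam_adm n.*2.+1)) E.
  by rewrite pmulr_rgt0 ?lam_gt0.
have [M _ HM] : \forall n \near \oo, 2^-1 <= lam n.*2.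
  have h : (0 : R) < 2^-1 by lra.
  have /cvgrPdist_le /(_ _ h) := lam_even_cvg lam_adm.
  by apply: filterS => n; rewrite ler_norml => /andP[_]; lra.
have := HM (maxn M N) (leq_maxl _ _); set n := maxn M N => /= hn.
have := HN n 0 (leq_maxr _ _); rewrite normr0 => /(_ (lexx _) D0).
have := E n; have := Q0 n.
have o0 := lam_gt0 lam_adm n.*2.+1.
have := lam_even_odd lam_adm n; have := lam_lt1 lam_adm n.*2.+2.
have := normr_ge0 (Q n.*2.+2).[0]; move: (`|_|) (`|_|) => a b; nra.
Qed.

End Growth.

(** * Uniform separation of the dual space inside (-1,1) *)

Section Separation.
Context {R : realType} (lam : nat -> R) (lam_adm : admissible lam).
Local Notation Q := (Qpoly lam).
Local Notation P := (Ppoly lam).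
Local Notation lamp := (lamp lam).

Lemma poly_lipschitz (p : {poly R}) : exists L, 0 <= L /\ forall x y,
  `|x| <= 1 -> `|y| <= 1 -> `|p.[x] - p.[y]| <= L * `|x - y|.
Proof.
elim/poly_ind: p => [|p c [L [L0 HL]]].
  by exists 0; split=> // x y _ _; rewrite !horner0 subrr normr0 mul0r.
exists (L + (`|p.[0]| + L)); split=> [|x y x1 y1]; first by rewrite !addr_ge0.
have -> : (p * 'X + c%:P).[x] - (p * 'X + c%:P).[y] =
  (p.[x] - p.[y]) * x + p.[y] * (x - y) by rewrite !hornerE; ring.
apply: (le_trans (ler_normD _ _)); rewrite !normrM mulrDl lerD //.
  rewrite -[leRHS]mulr1 ler_pM //; exact: HL.
rewrite ler_wpM2r //.
have := HL y 0 y1; rewrite normr0 ler01 subr0 => /(_ isT) h.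
rewrite -{1}(subrK p.[0] p.[y]) addrC; apply: (le_trans (ler_normD _ _)).
rewrite lerD2l; apply: (le_trans h); rewrite -[leRHS]mulr1.
by rewrite ler_wpM2l.
Qed.

(** The even subsequence has its own Christoffel-Darboux formula, in the variable x^2, and the decay
    estimate is available exactly at even indices. *)
Definition even_kernel M x y := \sum_(k < M) (Q k.*2).[x] * (Q k.*2).[y].

Lemma even_kernelS M x y : even_kernel M.+1 x y =
  even_kernel M x y + (Q M.*2).[x] * (Q M.*2).[y].
Proof. by rewrite /even_kernel big_ord_recr. Qed.

Lemma even_christoffel_darboux M x y :
  (y ^+ 2 - x ^+ 2) * even_kernel M.+1 x y = lam M.*2 * lam M.*2.+1 *
    ((Q M.*2.+2).[y] * (Q M.*2).[x] - (Q M.*2).[y] * (Q M.*2.+2).[x]).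
Proof.
elim: M => [|M IH].
  rewrite /even_kernel big_ord_recl big_ord0 !Q0_horner.
  have := mulxx_Q lam_adm 0 x; have := mulxx_Q lam_adm 0 y.
  rewrite !Q0_horner double0; move: (Q 2).[x] (Q 2).[y] => a b /=; lra.
rewrite even_kernelS mulrDr IH doubleS.
have := mulxx_Q lam_adm M.*2.+2 x; have := mulxx_Q lam_adm M.*2.+2 y.
rewrite -[M.*2.+2.-2]/M.*2 -[lamp _.+2]/(lam M.*2.+1).
rewrite -[lamp _.-1]/(lam M.*2).
move: (Q M.*2.+4) (Q M.*2.+2) (Q M.*2) => f4 f2 f0 Ey Ex.
have -> : (y ^+ 2 - x ^+ 2) * (f2.[x] * f2.[y]) =
  (y ^+ 2 * f2.[y]) * f2.[x] - (x ^+ 2 * f2.[x]) * f2.[y] by ring.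
by rewrite Ey Ex; ring.
Qed.

(** On the diagonal the kernel is a sum of squares that contains Q_0^2 = 1. The constant [L] depends
    on [M], so the length must be fixed before points are separated. *)
Lemma even_kernel_lipschitz M : exists L, 0 <= L /\ forall x y,
  dual_space P x -> dual_space P y -> 1 - L * `|x - y| <= even_kernel M.+1 x y.
Proof.
elim: M => [|M [L [L0 HL]]].
  exists 0; split=> // x y _ _.
  by rewrite /even_kernel big_ord_recl big_ord0 !Q0_horner mul0r subr0 mulr1 addr0.
have [l [l0 Hl]] := poly_lipschitz (Q M.+1.*2).
exists (L + (Q M.+1.*2).[1] * l); split=> [|x y Dx Dy].
  by rewrite addr_ge0 // mulr_ge0 // ltW // Q_at1_gt0.
rewrite even_kernelS.
have := HL x y Dx Dy.
have := Hl x y (dual_space_le1 lam_adm Dx) (dual_space_le1 lam_adm Dy).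
have /(dual_space_Q lam_adm)/(_ M.+1.*2) := Dx.
have q0 := Q_at1_gt0 lam_adm M.+1.*2; have d0 := normr_ge0 (x - y).
move: (even_kernel _ _ _) (Q _).[x] (Q _).[y] (Q _).[1] `|x - y| d0 q0
  => S a b v d d0 v0 av abd SL.
have : - (v * (l * d)) <= a * (b - a).
  have : `|a * (b - a)| <= v * (l * d) by rewrite normrM distrC ler_pM.
  by rewrite ler_norml => /andP[].
by have := sqr_ge0 a; lra.
Qed.

(** For x != y the Christoffel-Darboux formula sends long kernels to 0, while the decay bounds
    everything beyond a fixed length by 1/8. The kernel of that length is thus at most 3/8, which
    [even_kernel_lipschitz] forbids for close points. Nonnegative points are needed as the formula
    only sees y^2 - x^2. *)
Lemma dual_space_separated r : r < 1 -> exists eta, 0 < eta /\ forall x y,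
  dual_space P x -> dual_space P y -> 0 <= x <= r -> 0 <= y <= r -> x != y ->
  eta <= `|x - y|.
Proof.
move=> r1; have [N [B [B0 HB]]] := dual_space_decay lam_adm r1.
have [j Hj] := exists_expr2_gt (8 * B ^+ 2).
have [L [L0 HL]] := even_kernel_lipschitz (N + j).
(* From 1 - L |x - y| <= 3/8 follows (L + 1) |x - y| >= 5/8; adding 1 avoids division by zero. *)
exists (2 * (L + 1))^-1; split; first by rewrite invr_gt0; lra.
move=> x y Dx Dy /andP[x0 xr] /andP[y0 yr] xy.
have Hb k : `|(Q (N + k).*2).[x] * (Q (N + k).*2).[y]| <= B ^+ 2 / 2 ^+ k.
  rewrite normrM expr2 mulrAC; apply: ler_pM => //.
    by apply: HB => //; rewrite ger0_norm.
  apply: (le_trans (HB k y _ Dy)); first by rewrite ger0_norm.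
  by rewrite ler_pdivrMr ?exprn_gt0 // ler_peMr ?(ltW B0) // exprn_ege1 // ler1n.
have tail i : `|even_kernel (N + j + i).+1 x y - even_kernel (N + j).+1 x y|
    <= B ^+ 2 / 2 ^+ j - B ^+ 2 / 2 ^+ (j + i).
  elim: i => [|i IH]; first by rewrite !addn0 !subrr normr0.
  rewrite addnS even_kernelS addrAC; apply: (le_trans (ler_normD _ _)).
  have := Hb (j + i.+1)%N; rewrite addnA addnS => /(lerD IH) /le_trans; apply.
  by rewrite addnS [2 ^+ _.+1]exprS invfM; lra.
have xy2 : 0 < `|y ^+ 2 - x ^+ 2|.
  have yx : 0 < y + x.
    rewrite lt0r addr_ge0 // andbT paddr_eq0 //.
    by apply: contraNN xy => /andP[/eqP-> /eqP->].
  by rewrite normr_gt0 subr_sqr mulf_neq0 // ?(gt_eqF yx) // subr_eq0 eq_sym.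
(* Only [i] depends on the two points; [j] and [L], and therefore the separation constant, do
   not. *)
have [i Hi] := exists_expr2_gt (8 * B ^+ 2 / `|y ^+ 2 - x ^+ 2|).
have small : `|even_kernel (N + j + i).+1 x y| <= 4^-1.
  rewrite -(ler_pM2l xy2) -normrM even_christoffel_darboux normrM.
  have A1 : `|lam (N + j + i).*2 * lam (N + j + i).*2.+1| <= 1.
    rewrite ger0_norm; last by rewrite mulr_ge0 // ltW ?lam_gt0.
    by rewrite mulr_ile1 ?(ltW (lam_gt0 _ _)) ?(ltW (lam_lt1 _ _)).
  have dec k z : `|z| <= r -> dual_space P z ->
      `|(Q (N + j + i + k).*2).[z]| <= B / 2 ^+ i.
    move=> zr Dz; rewrite -!addnA; apply: (le_trans (HB _ _ zr Dz)).
    by rewrite ler_pM2l // lef_pV2 ?posrE ?exprn_gt0 // ler_weXn2l; [|lra|lia].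
  have [xr' yr'] : `|x| <= r /\ `|y| <= r by rewrite !ger0_norm.
  have prod z w k l : `|z| <= r -> dual_space P z -> `|w| <= r ->
      dual_space P w -> `|(Q (N + j + i + k).*2).[z] * (Q (N + j + i + l).*2).[w]|
      <= B ^+ 2 / 2 ^+ i.
    move=> zr Dz wr Dw; rewrite normrM expr2 mulrAC; apply: ler_pM => //.
      exact: dec.
    apply: (le_trans (dec l w wr Dw)).
    by rewrite ler_pdivrMr ?exprn_gt0 // ler_peMr ?(ltW B0) // exprn_ege1 // ler1n.
  have := prod y x 1 0 yr' Dy xr' Dx; have := prod y x 0 1 yr' Dy xr' Dx.
  rewrite !addn0 !addn1 doubleS.
  move: (Q _).[y] (Q _).[x] (Q _).[y] (Q _).[x] => a b c d h1 h2.
  apply: (@le_trans _ _ (1 * (2 * (B ^+ 2 / 2 ^+ i)))).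
    rewrite ler_pM //; apply: (le_trans (ler_normB _ _)); lra.
  move: Hi; rewrite ltr_pdivrMr // mul1r => Hi.
  rewrite mulrA ler_pdivrMr ?exprn_gt0 //; lra.
have tl := tail i; have Lxy := HL x y Dx Dy.
have h : B ^+ 2 / 2 ^+ j <= 8^-1.
  by rewrite ler_pdivrMr ?exprn_gt0 //; lra.
have h' : 0 <= B ^+ 2 / 2 ^+ (j + i) by rewrite divr_ge0 ?sqr_ge0 ?exprn_ge0.
have d0 := normr_ge0 (x - y).
have : 1 - L * `|x - y| <= 3 / 8.
  apply: (le_trans Lxy); move: tl small; rewrite !ler_norml => /andP[+ _] /andP[_ +].
  by move: h h'; lra.
move=> Ld; rewrite -[leLHS]mul1r ler_pdivrMr; lra.
Qed.

End Separation.

(** * Increasing enumeration of a separated set accumulating at 1 *)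

Section Enumeration.
Context {R : realType} (D : set R).
Hypothesis D01 : forall x, D x -> 0 < x < 1.
Hypothesis D_separated : forall r, r < 1 -> exists eta, 0 < eta /\ forall x y,
  D x -> D y -> 0 <= x <= r -> 0 <= y <= r -> x != y -> eta <= `|x - y|.
Hypothesis D_near1 : forall r, r < 1 -> exists2 x, D x & r < x.

(** Descending in D from a point above [a] loses at least eta each time, so the descent ends at a
    least element. *)
Lemma exists_next a : a < 1 ->
  exists b, [/\ D b, a < b & forall y, D y -> a < y -> b <= y].
Proof.
move=> /D_near1[z Dz az]; have /andP[z0 z1] := D01 Dz.
have [eta [eta0 sep]] := D_separated z1.
suff H k w : D w -> a < w -> w <= z -> w - a < k%:R * eta ->
    exists b, [/\ D b, a < b & forall y, D y -> a < y -> b <= y].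
  apply: (H (Num.truncn ((z - a) / eta)).+1 z) => //.
  by rewrite -ltr_pdivrMr // truncnS_gt.
elim: k w => [|k IH] w Dw aw wz wk; first by rewrite mul0r in wk; lra.
have [wmin|] := pselect (forall y, D y -> a < y -> w <= y); first by exists w.
move=> /existsNP[y] /not_implyP[Dy] /not_implyP[ay] /negP; rewrite -ltNge => yw.
have /andP[y0 _] := D01 Dy; have /andP[w0 _] := D01 Dw.
apply: (IH y) => //; first lra.
have := sep w y Dw Dy; rewrite (ltW w0) wz (ltW y0) (ltW (lt_le_trans yw wz)).
move=> /(_ isT isT); rewrite gt_eqF // => /(_ isT); rewrite gtr0_norm ?subr_gt0 //.
by move: wk; rewrite -natr1 mulrDl mul1r; lra.
Qed.

Lemma increasing_in_unbounded x : strictly_increasing x ->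
  (forall n, D (x n)) -> forall r, r < 1 -> exists n, r < x n.
Proof.
move=> incr Dx r r1; have [eta [eta0 sep]] := D_separated r1.
have x0 n : 0 < x n by have /andP[] := D01 (Dx n).
apply/not_existsP => H.
have xr n : x n <= r by rewrite leNgt; apply/negP/H.
have Hn n : n%:R * eta < x n.
  elim: n => [|n IH]; first by rewrite mul0r.
  have := sep (x n.+1) (x n) (Dx _) (Dx _); rewrite !xr !(ltW (x0 _)).
  move=> /(_ isT isT); rewrite gt_eqF // => /(_ isT).
  by rewrite gtr0_norm ?subr_gt0 // -natr1 mulrDl mul1r; lra.
have := truncnS_gt (r / eta); rewrite ltr_pdivrMr //.
have := Hn (Num.truncn (r / eta)).+1; have := xr (Num.truncn (r / eta)).+1.
lra.
Qed.

(** Iterating the successor from 0 lists D: a point left out would stay above the whole sequence,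
    which passes every r < 1. *)
Lemma enumerate : exists x, node_sequence x /\ forall y, D y <-> exists n, y = x n.
Proof.
have /choice[f Hf] : forall a, exists b,
    a < 1 -> [/\ D b, a < b & forall y, D y -> a < y -> b <= y].
  move=> a; have [/exists_next[b Hb]|na] := pselect (a < 1); first by exists b.
  by exists 0 => /na.
pose x n := iter n.+1 f 0.
have Dx n : D (x n).
  elim: n => [|n /D01/andP[_ /Hf[]]//].
  by have [] := Hf 0 ltr01.
have x1 n : x n < 1 by have /D01/andP[] := Dx n.
have incr : strictly_increasing x by move=> n; have [] := Hf _ (x1 n).
have unb := increasing_in_unbounded incr Dx.
have mono m n : (m <= n)%N -> x m <= x n.
  move=> /subnK <-; elim: (n - m)%N => [//|k IH]; rewrite addSn.
  exact: le_trans IH (ltW (incr _)).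
exists x; split; [split=> // [n|]|move=> y; split=> [Dy|[n ->]//]].
- exact: D01.
- apply/cvgrPdist_le => e e0; have [|N xN] := unb (1 - e); first lra.
  exists N => // n /= /mono Nn.
  by rewrite ger0_norm ?subr_ge0 ?(ltW (x1 n)) //; lra.
- apply: contrapT => /forallNP H; have /andP[y0 y1] := D01 Dy.
  have xy n : x n < y.
    rewrite lt_neqAle; apply/andP; split; first by apply/eqP => /esym/H.
    elim: n => [|n IH].
      by have [_ _ /(_ y Dy y0)] := Hf 0 ltr01.
    have [_ _] := Hf _ (x1 n); apply => //.
    by rewrite lt_neqAle IH andbT; apply/eqP => /esym/H.
  by have [n /ltW] := unb y y1; rewrite leNgt xy.
Qed.

End Enumeration.

(** * The construction from convex null sequences *)

Section ConvexNull.
Context {R : realType} (s : nat -> R) (s_convex : convex_null_sequence s).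

Lemma lam_of_even n : lam_of s n.*2 = 1 - s n.
Proof. by rewrite /lam_of odd_double -muln2 mulnK. Qed.

Lemma lam_of_odd n : lam_of s n.*2.+1 = s n.+1 - s n.+2.
Proof.
rewrite /lam_of /= odd_double /=; congr (s _ - s _).
  by rewrite addn1 -doubleS -muln2 mulnK.
by rewrite addn3 -!doubleS -muln2 mulnK.
Qed.

(** By convexity a single step without decrease would propagate and keep the sequence above a
    positive constant. *)
Lemma convex_null_decr n : s n.+1 < s n.
Proof.
have [s01 s_cvg cvx] := s_convex.
have grow m k : s m <= s m.+1 -> s (m + k)%N <= s (m + k).+1.
  elim: k => [|k IH] h; first by rewrite addn0.
  rewrite addnS; have := IH h; have := cvx (m + k)%N.
  by rewrite ler_pdivlMr //; lra.
rewrite ltNge; apply/negP => /grow Hk.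
have ge k : s n <= s (n + k)%N.
  by elim: k => [|k IH]; rewrite ?addn0 // addnS (le_trans IH).
have sn0 : 0 < s n by have /andP[] := s01 n.
have sn20 : 0 < s n / 2 by rewrite divr_gt0.
have /cvgrPdist_le /(_ _ sn20) [N _ HN] := s_cvg.
have := HN (n + N)%N (leq_addl _ _); rewrite sub0r normrN.
have := ge N; move=> h; rewrite ger0_norm; lra.
Qed.

(** The first admissibility inequality is convexity itself; the second telescopes to an equality. *)
Lemma lam_of_admissible : admissible (lam_of s).
Proof.
have [s01 s_cvg cvx] := s_convex; split=> [n||[//|n] _].
- rewrite -[n]odd_double_half; case: (odd n); rewrite ?add1n ?add0n.
    rewrite lam_of_odd; have := convex_null_decr n./2.+1.
    by have := s01 n./2.+1; have := s01 n./2.+2; lra.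
  by rewrite lam_of_even; have := s01 n./2; lra.
- under eq_fun => n do rewrite mul2n lam_of_even.
  have := cvgB (cvg_cst (1 : R)) s_cvg; rewrite subr0; exact.
have -> : (2 * n.+1 - 2)%N = n.*2 by lia.
have -> : (2 * n.+1 - 1)%N = n.*2.+1 by lia.
have -> : (2 * n.+1)%N = n.+1.*2 by lia.
have -> : (n.+1.*2 + 2)%N = n.+2.*2 by lia.
rewrite !lam_of_even lam_of_odd.
by have := cvx n; rewrite ler_pdivlMr //; split; lra.
Qed.

End ConvexNull.

(** * The value h(1) and the lower bound for the nodes *)

Section FirstHaar.
Context {R : realType}.
Implicit Types (lam s : nat -> R) (eps : R).

Lemma haar1E lam : admissible lam -> haar (Ppoly lam) 1 = (lam 0 ^+ 2)^-1.
Proof.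
move=> lam_adm; rewrite (haarE lam_adm) -exprVn; congr (_ ^+ 2).
by rewrite /= hornerZ hornerX mulr1.
Qed.

Lemma haar1_lam_of eps s : 0 < eps -> convex_null_sequence s ->
  s 0 = 1 - 1 / Num.sqrt (1 + eps) -> haar (Ppoly (lam_of s)) 1 = 1 + eps.
Proof.
move=> eps0 s_convex s0; rewrite haar1E; last exact: lam_of_admissible.
rewrite -[lam_of s 0]/(lam_of s 0.*2) lam_of_even s0 opprB addrC subrK.
by rewrite mul1r exprVn invrK sqr_sqrtr //; lra.
Qed.

Lemma exists_convex_null_sequence (a : R) : 0 < a < 1 ->
  exists2 s, convex_null_sequence s & s 0 = a.
Proof.
move=> /andP[a0 a1]; exists (geometric a 2^-1); last by rewrite /= expr0 mulr1.
have p n : 0 < a * 2^-1 ^+ n by rewrite mulr_gt0 // exprn_gt0.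
split=> [n||n] /=.
- rewrite p (le_lt_trans _ a1) // ler_piMr ?(ltW a0) // exprn_ile1 //; lra.
- by apply: cvg_geometric; rewrite ger0_norm; lra.
- by rewrite !exprS; have := p n; lra.
Qed.

Lemma exists_haar1 eps : 0 < eps -> exists lam : nat -> R,
  admissible lam /\ haar (Ppoly lam) 1 = 1 + eps.
Proof.
move=> eps0; have sq1 : 1 < Num.sqrt (1 + eps).
  by rewrite -{1}sqrtr1 ltr_sqrt; lra.
have [|s s_convex s0] := @exists_convex_null_sequence (1 - 1 / Num.sqrt (1 + eps)).
  rewrite mul1r subr_gt0 invf_lt1 ?sq1 ?(lt_trans _ sq1) //=.
  by rewrite gtrBl invr_gt0 (lt_trans _ sq1).
exists (lam_of s); split; first exact: lam_of_admissible.
exact: haar1_lam_of.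
Qed.

Lemma dual_space_lower_bound lam eps x : admissible lam -> 0 < eps ->
  haar (Ppoly lam) 1 = 1 + eps -> 0 <= x -> dual_space (Ppoly lam) x ->
  Num.sqrt ((1 - eps) / (1 + eps)) <= x.
Proof.
move=> lam_adm eps0; rewrite haar1E // => h1 x0 /(dual_space_sqr lam_adm).
have -> : lam 0 ^+ 2 = (1 + eps)^-1 by rewrite -h1 invrK.
have -> : 2 * (1 + eps)^-1 - 1 = (1 - eps) / (1 + eps).
  by field; rewrite gt_eqF //; lra.
by rewrite -{2}(ger0_norm x0) -sqrtr_sqr; exact: ler_wsqrtr.
Qed.

End FirstHaar.

(** * Integration of polynomials and the support *)

Section PolynomialIntegral.
Context {R : realType} (mu : probability (measurableTypeR R) R).
Hypothesis mu_int : forall p : {poly R}, mu.-integrable setT (EFin \o horner p).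
Implicit Types (p q : {poly R}) (A N V : set (measurableTypeR R)).

Definition poly_int p : R := (\int[mu]_x p.[x])%R.
Local Notation I := poly_int.

Lemma poly_intD p q : I (p + q) = I p + I q.
Proof.
rewrite /poly_int -RintegralD //.
by apply: eq_Rintegral => x _; rewrite hornerD.
Qed.

Lemma poly_intZ a p : I (a *: p) = a * I p.
Proof.
rewrite /poly_int -RintegralZl //.
by apply: eq_Rintegral => x _; rewrite hornerZ.
Qed.

Lemma poly_intB p q : I (p - q) = I p - I q.
Proof. by rewrite -scaleN1r poly_intD poly_intZ mulN1r. Qed.

Lemma poly_int1 : I 1 = 1.
Proof.
rewrite /poly_int (@eq_Rintegral _ _ _ _ _ (fun=> 1)) => [|x _]; last by rewrite hornerC.
by rewrite Rintegral_cst // mul1r; exact: (congr1 fine (probability_setT mu)).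
Qed.

Lemma EFin_poly_int p : (\int[mu]_x p.[x]%:E = (I p)%:E)%E.
Proof.
rewrite /poly_int /Rintegral fineK //.
by rewrite (integrable_fin_num measurableT (mu_int p)).
Qed.

Lemma poly_innerE p q : poly_inner mu p q = (I (p * q))%:E.
Proof.
rewrite -EFin_poly_int /poly_inner.
by apply: eq_integral => x _; rewrite hornerM.
Qed.

Lemma poly_int_ge0 N p : measurable N -> mu N = 0%E ->
  (forall x, ~ N x -> 0 <= p.[x]) -> 0 <= I p.
Proof.
move=> mN N0 p0; rewrite -lee_fin -EFin_poly_int.
rewrite (negligible_integral mN measurableT (mu_int p) N0).
by apply: integral_ge0 => x [_ /p0]; rewrite lee_fin.
Qed.

Lemma poly_int_markov A p c : measurable A -> 0 <= c ->
  (forall x, 0 <= p.[x]) -> (forall x, A x -> c <= p.[x]) ->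
  (c%:E * mu A <= (I p)%:E)%E.
Proof.
move=> mA c0 p0 pc; rewrite -EFin_poly_int -integral_cst //.
have mp (B : set (measurableTypeR R)) :
    measurable_fun B (fun x : measurableTypeR R => p.[x]%:E).
  by apply/measurable_EFinP; exact: measurable_poly.
apply: (@le_trans _ _ (\int[mu]_(x in A) p.[x]%:E)%E).
  by apply: ge0_le_integral => //; apply: mp.
apply: (ge0_subset_integral mu mA measurableT (mp setT)) => //.
by move=> x _; rewrite lee_fin.
Qed.

End PolynomialIntegral.

Section Support.
Context {R : realType} (mu : probability (measurableTypeR R) R).

(** Countably many null intervals with rational endpoints cover V; [F] enumerates them and puts
    [set0] for all other codes. *)
Lemma open_null (V : set R) : open V ->
  (forall x, V x -> ~ measure_support mu x) -> mu V = 0%E.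
Proof.
move=> oV Vsupp.
pose F (k : nat) : set R := if unpickle k is Some (p, q) then
  (if mu `]ratr p, ratr q[%classic == 0%E then `]ratr p, ratr q[%classic else set0)
  else set0.
have F0 k : mu.-negligible (F k).
  rewrite /F; case: (unpickle k) => [[p q]|]; last exact: negligible_set0.
  by case: eqP => [h|_]; [apply/negligibleP|exact: negligible_set0].
apply: measure_negligible; first exact: open_measurable.
apply: negligibleS (negligible_bigcup F0) => x Vx.
have /existsNP[U /not_implyP[oU /not_implyP[Ux /negP]]] := Vsupp x Vx.
rewrite -leNgt measure_le0 => /eqP U0.
have /nbhs_ballP[e e0 eU] : nbhs x U by exact: open_nbhs_nbhs.
have [|p] := @rat_in_itvoo R (x - e) x; first by rewrite ltrBlDr ltrDl.
rewrite in_itv /= => /andP[xp px].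
have [|q] := @rat_in_itvoo R x (x + e); first by rewrite ltrDl.
rewrite in_itv /= => /andP[xq qx].
exists (pickle (p, q)); [exact: Logic.I|rewrite /F pickleK].
have -> : mu `]ratr p, ratr q[%classic = 0%E.
  apply/eqP; rewrite -measure_le0 -U0; apply: le_measure; rewrite ?inE //.
    exact: open_measurable.
  move=> y; rewrite /= in_itv /= => /andP[py yq]; apply: eU.
  by rewrite /ball /= ltr_norml; apply/andP; split; lra.
by rewrite eqxx /= in_itv /= px xq.
Qed.

End Support.

(** * Orthonormality, and the support compared with the dual space *)

Section Orthogonality.
Context {R : realType} (lam : nat -> R) (lam_adm : admissible lam).
Context (mu : probability (measurableTypeR R) R).
Hypothesis mu_orth : orthogonalization_measure (Ppoly lam) mu.
Local Notation Q := (Qpoly lam).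
Local Notation P := (Ppoly lam).
Local Notation lamp := (lamp lam).
Local Notation I := (poly_int mu).

Lemma integrable_poly (p : {poly R}) : mu.-integrable setT (EFin \o horner p).
Proof.
pose J (q : {poly R}) := mu.-integrable setT (EFin \o horner q).
have JD q1 q2 : J q1 -> J q2 -> J (q1 + q2).
  move=> J1 J2; apply: eq_integrable (integrableD measurableT J1 J2) => // x _.
  by rewrite /= hornerD EFinD.
have JZ a q : J q -> J (a *: q).
  move=> Jq; apply: eq_integrable (integrableZl measurableT a Jq) => // x _.
  by rewrite /= hornerZ EFinM.
have JP n : J (P n).
  have [Pint _] := mu_orth; apply: eq_integrable (Pint n 0) => // x _.
  by rewrite /= Ppoly0 hornerC mulr1.
have J0 : J 0 by rewrite -(scale0r (P 0)); exact: JZ.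
(* Since P_1 = X, powers of X are products of P_1 and expand in the P_k. *)
have Xn n : cone P ('X^n).
  elim: n => [|n IH]; first by rewrite expr0 -(Ppoly0 lam); exact: cone_gen.
  rewrite exprS -[X in X * _](Ppoly1 lam_adm).
  by apply: cone_mul => //; [exact: cone_PP|exact: cone_gen].
rewrite -[p]coefK poly_def; apply: (big_ind J) => // i _; apply: (JZ).
have [c _ ->] := Xn i; rewrite /combination.
by apply: (big_ind J) => // k _; apply: JZ.
Qed.

Let intD := poly_intD integrable_poly.
Let intB := poly_intB integrable_poly.
Let intZ := poly_intZ integrable_poly.

Lemma poly_int_PP m n : m != n -> I (P m * P n) = 0.
Proof.
move=> mn; have [_ /(_ m n)[PP0 _]] := mu_orth.
apply: contrapT => H0; move/eqP: mn; apply; apply: PP0.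
by rewrite (poly_innerE integrable_poly) => -[].
Qed.

(** Orthogonality is inherited from P. The norms agree because integrating X Q_n Q_(n+1) in two ways
    gives the same coefficient [lam n] on both sides; the total mass 1 starts the induction. *)
Lemma poly_int_QQ m n : I (Q m * Q n) = (m == n)%:R.
Proof.
have neq k l : k != l -> I (Q k * Q l) = 0.
  move=> kl; rewrite (Q_P lam_adm k) (Q_P lam_adm l) -scalerAl -scalerAr !intZ.
  by rewrite poly_int_PP // !mulr0.
have [<-|/neq//] := eqVneq m n.
elim: m {n} => [|n IH]; first by rewrite mul1r poly_int1.
apply: (mulfI (lam_neq0 lam_adm n)); rewrite -[in RHS]IH.
have : lam n *: (Q n.+1 * Q n.+1) + lamp n *: (Q n.-1 * Q n.+1) =
    lam n.+1 *: (Q n.+2 * Q n) + lam n *: (Q n * Q n).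
  move: (Q) (mulX_Q lam_adm) => F XF.
  have : ('X * F n) * F n.+1 = ('X * F n.+1) * F n by ring.
  by rewrite !XF !mulrDl -!scalerAl.
move=> /(congr1 I); rewrite !intD !intZ.
rewrite [I (Q n.-1 * _)]neq; last by lia.
rewrite [I (Q n.+2 * _)]neq; last by lia.
by rewrite !mulr0 addr0 add0r.
Qed.

Lemma poly_int_QX n : I (('X * Q n) ^+ 2) = lam n ^+ 2 + lamp n ^+ 2.
Proof.
rewrite expr2 (mulX_Q lam_adm).
have -> : (lam n *: Q n.+1 + lamp n *: Q n.-1) * (lam n *: Q n.+1 + lamp n *: Q n.-1)
  = lam n ^+ 2 *: (Q n.+1 * Q n.+1) + (2 * lam n * lamp n) *: (Q n.+1 * Q n.-1)
    + lamp n ^+ 2 *: (Q n.-1 * Q n.-1).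
  by move: (Q) => F; rewrite -!mul_polyC !(polyCM, expr2); ring.
rewrite !intD !intZ !poly_int_QQ !eqxx.
have -> : (n.+1 == n.-1) = false by lia.
by rewrite !mulr1 mulr0 addr0.
Qed.

Lemma Qpoly_orthonormal : orthonormal_polynomials mu Q.
Proof.
split=> [n|n|m n|m n].
- exact: size_Qpoly.
- exact: lead_coef_Qpoly_gt0.
- apply: eq_integrable (integrable_poly (Q m * Q n)) => // x _.
  by rewrite /= hornerM.
- by rewrite (poly_innerE integrable_poly) poly_int_QQ.
Qed.

(** Each P_i has integral 0 or 1, while its value at 1 is always 1. *)
Lemma poly_int_cone p : cone P p -> I p <= p.[1].
Proof.
move=> [c c0 ->]; rewrite /combination horner_sum; elim/big_ind2: _.
- by rewrite -(scale0r 1) intZ mul0r.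
- by move=> p1 a1 p2 a2 h1 h2; rewrite intD lerD.
move=> i _; rewrite intZ hornerZ ler_wpM2l //.
rewrite (Ppoly_at1 lam_adm) -[P i]mul1r -(Ppoly0 lam).
have [i0|i0] := eqVneq 0 (i : nat); last by rewrite poly_int_PP // ler01.
by rewrite -i0 Ppoly0 mul1r poly_int1.
Qed.

(* Nonnegative linearization bounds all even moments of [P n] by 1. *)
Lemma support_sub_dual x : measure_support mu x -> dual_space P x.
Proof.
move=> mux; apply/dual_space_P => n; rewrite leNgt; apply/negP => Px1.
pose c := (1 + `|(P n).[x]|) / 2.
have c1 : 1 < c by rewrite /c; lra.
have cP : c < `|(P n).[x]| by rewrite /c; lra.
pose U := [set y : R | c ^+ 2 < ((P n) ^+ 2).[y]].
have oU : open U.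
  apply: (@open_comp _ _ (horner (P n ^+ 2)) [set z | c ^+ 2 < z]).
    by move=> y _; exact: continuous_horner.
  exact: open_gt.
have sq y : ((P n) ^+ 2).[y] = `|(P n).[y]| ^+ 2.
  by rewrite horner_exp real_normK ?num_real.
have Ux : U x by rewrite /U /= sq ltr_pXn2r // nnegrE //; lra.
have := mux U oU Ux.
have muU : mu U \is a fin_num by apply: fin_num_measure; exact: open_measurable.
rewrite -(fineK muU) lte_fin => m0.
have bound k : c ^+ 2 ^+ k * fine (mu U) <= 1.
  rewrite -lee_fin EFinM fineK //.
  apply: (@le_trans _ _ (I (P n ^+ 2 ^+ k))%:E).
    apply: (poly_int_markov integrable_poly (open_measurable oU)).
    - by rewrite !exprn_ge0 //; lra.
    - by move=> y; rewrite horner_exp sq !exprn_ge0.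
    - move=> y /ltW Uy; rewrite horner_exp lerXn2r ?nnegrE ?exprn_ge0 //; first lra.
      by rewrite sq exprn_ge0.
  rewrite lee_fin.
  have -> : (1 : R) = (P n ^+ 2 ^+ k).[1].
    by rewrite !horner_exp (Ppoly_at1 lam_adm) !expr1n.
  apply: poly_int_cone; rewrite -exprM; elim: (2 * k)%N => [|j IH].
    by rewrite expr0 -(Ppoly0 lam); exact: cone_gen.
  by rewrite exprS; apply: cone_mul => //; [exact: cone_PP|exact: cone_gen].
have [|k] := @exists_expr_gt R (c ^+ 2) (fine (mu U))^-1.
  by rewrite exprn_egt1 //; lra.
by rewrite -[_^-1]mul1r ltr_pdivrMr // ltNge bound.
Qed.

(** The truncated eigenvector of J at x, realized as a polynomial in the integration variable. *)
Definition kernel M x : {poly R} := \sum_(k < M.+1) (Q k).[x] *: Q k.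

Lemma kernelS M x : kernel M.+1 x = kernel M x + (Q M.+1).[x] *: Q M.+1.
Proof. by rewrite /kernel big_ord_recr. Qed.

Lemma christoffel_darboux M x : ('X - x%:P) * kernel M x =
  lam M *: ((Q M).[x] *: Q M.+1 - (Q M.+1).[x] *: Q M).
Proof.
have XQ := mulX_Q lam_adm; have xQ := mulx_Q lam_adm.
have Q0 : Q 0 = 1 by [].
rewrite /kernel; move: (Q) XQ xQ Q0 => F XQ xQ Q0; elim: M => [|M IH].
  rewrite big_ord_recl big_ord0 addr0 scalerBr !scalerA mulrBl.
  have := xQ 0 x; have := XQ 0.
  rewrite scale0r mul0r !addr0 Q0 hornerC !mulr1 => <- <-.
  by rewrite scale1r !mulr1 alg_polyC.
rewrite big_ord_recr /= mulrDr IH -scalerAr mulrBl XQ.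
rewrite [x%:P * _]mul_polyC !scalerBr !scalerDr !scalerA [_ * x]mulrC xQ.
rewrite -[lamp _]/(lam M) -[M.+1.-1]/M.
rewrite -!mul_polyC !(polyCD, polyCM); ring.
Qed.

Lemma poly_int_kernel M x : 1 <= I (kernel M x ^+ 2).
Proof.
have orth K j : (K < j)%N -> I (kernel K x * Q j) = 0.
  elim: K => [|K IH] Kj.
    rewrite /kernel big_ord_recl big_ord0 addr0 -scalerAl intZ poly_int_QQ.
    by rewrite (ltn_eqF Kj) mulr0.
  rewrite kernelS mulrDl intD IH ?(ltnW Kj) // -scalerAl intZ poly_int_QQ.
  by rewrite (ltn_eqF Kj) mulr0 addr0.
elim: M => [|M IH].
  rewrite /kernel big_ord_recl big_ord0 addr0 Q0_horner scale1r expr2.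
  by rewrite poly_int_QQ.
have -> : kernel M.+1 x ^+ 2 = kernel M x ^+ 2
    + (2 * (Q M.+1).[x]) *: (kernel M x * Q M.+1)
    + (Q M.+1).[x] ^+ 2 *: (Q M.+1 * Q M.+1).
  rewrite kernelS; move: (kernel M x) (Q M.+1) => k q.
  by rewrite -!mul_polyC !(polyCM, expr2); ring.
rewrite !intD !intZ orth // mulr0 addr0 poly_int_QQ eqxx mulr1.
by rewrite (le_trans IH) // lerDl sqr_ge0.
Qed.

(** Off the ball (y - x)^2 >= e^2, so e^2 times the integral of K^2 is at most that of ((y - x)
    K)^2. The former integral is at least 1, and the latter reduces by Christoffel-Darboux to the
    boundary term. *)
Lemma kernel_gap x e M : 0 < e -> mu (ball x e) = 0%E ->
  e ^+ 2 <= lam M ^+ 2 * ((Q M).[x] ^+ 2 + (Q M.+1).[x] ^+ 2).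
Proof.
move=> e0 ball0.
have I1 : I ((('X - x%:P) * kernel M x) ^+ 2) =
    lam M ^+ 2 * ((Q M).[x] ^+ 2 + (Q M.+1).[x] ^+ 2).
  rewrite christoffel_darboux.
  have -> : (lam M *: ((Q M).[x] *: Q M.+1 - (Q M.+1).[x] *: Q M)) ^+ 2 =
    lam M ^+ 2 *: ((Q M).[x] ^+ 2 *: (Q M.+1 * Q M.+1)
      - (2 * (Q M).[x] * (Q M.+1).[x]) *: (Q M * Q M.+1)
      + (Q M.+1).[x] ^+ 2 *: (Q M * Q M)).
    move: (Q M) (Q M.+1) => k q.
    by rewrite -!mul_polyC !(polyCM, expr2); ring.
  rewrite intZ intD intB !intZ !poly_int_QQ !eqxx.
  by rewrite (ltn_eqF (ltnSn M)) mulr0 subr0 !mulr1.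
have mball : measurable (ball x e : set (measurableTypeR R)).
  by apply: open_measurable; exact: ball_open.
have : 0 <= I ((('X - x%:P) * kernel M x) ^+ 2 - e ^+ 2 *: kernel M x ^+ 2).
  apply: (poly_int_ge0 integrable_poly mball ball0) => y xy.
  rewrite hornerD hornerN hornerZ !horner_exp hornerM hornerXsubC exprMn.
  rewrite -mulrBl mulr_ge0 ?sqr_ge0 //.
  rewrite subr_ge0 -[(y - x) ^+ 2]real_normK ?num_real //.
  rewrite ler_pXn2r ?nnegrE ?(ltW e0) // leNgt; apply/negP => yx; apply: xy.
  by rewrite /ball /= distrC.
rewrite intB intZ I1 subr_ge0; apply: le_trans.
by rewrite ler_peMr ?sqr_ge0 // poly_int_kernel.
Qed.

Lemma dual_sub_support x : dual_space P x -> `|x| < 1 -> measure_support mu x.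
Proof.
move=> Dx x1 U oU Ux; rewrite lt0e measure_ge0 andbT; apply/eqP => U0.
have x0 : 0 < `|x|.
  by rewrite normr_gt0; apply: contra_not_neq (dual_spaceN0 lam_adm) => <-.
have /nbhs_ballP[e e0 eU] : nbhs x U by exact: open_nbhs_nbhs.
have ball0 : mu (ball x e) = 0%E.
  apply/eqP; rewrite -measure_le0 -U0; apply: le_measure; rewrite ?inE //.
    by apply: open_measurable; exact: ball_open.
  exact: open_measurable.
have [N [B [B0 HB]]] := dual_space_decay lam_adm x1.
(* With b = B / 2^k, the boundary term times |x|^2 is at most (4 + 1) b^2: the 4 comes from the odd
   index, the 1 from the even one. The constant 8 leaves room. *)
have [k Hk] := exists_expr2_gt (8 * B ^+ 2 / (e * `|x|) ^+ 2).
have := kernel_gap (N + k).*2.+1 e0 ball0.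
have := HB k x (lexx _) Dx; have := HB k.+1 x (lexx _) Dx.
rewrite addnS doubleS; set n := (N + k).*2 => h2 h0.
have b0 : 0 < B / 2 ^+ k by rewrite divr_gt0 ?exprn_gt0.
have h2' : `|(Q n.+2).[x]| <= B / 2 ^+ k.
  by apply: (le_trans h2); rewrite [2 ^+ _.+1]exprS invfM; lra.
(* The odd-index value is controlled by its even neighbours through the recurrence, at the price of
   a factor |x|; this is where x != 0 matters. *)
have h1 : `|x| * `|(Q n.+1).[x]| <= 2 * (B / 2 ^+ k).
  rewrite -normrM (mulx_Q lam_adm) -[lamp _]/(lam n) -[n.+1.-1]/n.
  apply: (le_trans (ler_normD _ _)); rewrite !normrM mulr_natl mulr2n.
  rewrite (gtr0_norm (lam_gt0 lam_adm n.+1)) (gtr0_norm (lam_gt0 lam_adm n)).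
  apply: lerD.
    by rewrite (le_trans _ h2') // ler_piMl // ltW ?lam_lt1.
  by rewrite (le_trans _ h0) // ler_piMl // ltW ?lam_lt1.
have bk : 8 * (B / 2 ^+ k) ^+ 2 < (e * `|x|) ^+ 2.
  move: Hk; rewrite ltr_pdivrMr ?exprn_gt0 ?mulr_gt0 // => Hk.
  rewrite expr_div_n mulrA ltr_pdivrMr ?exprn_gt0 // (lt_le_trans Hk) // mulrC.
  by rewrite ler_pM2l ?exprn_gt0 ?mulr_gt0 // ler_eXnr // exprn_ege1 // ler1n.
apply/negP; rewrite -ltNge.
have x2 : 0 < `|x| ^+ 2 by rewrite exprn_gt0.
rewrite -(ltr_pM2l x2) -exprMn [_ * e]mulrC; apply: le_lt_trans bk.
have l1 : lam n.+1 ^+ 2 <= 1 by rewrite exprn_ile1 ?ltW ?lam_gt0 ?lam_lt1.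
have k1 : `|x| ^+ 2 * (Q n.+1).[x] ^+ 2 <= (2 * (B / 2 ^+ k)) ^+ 2.
  rewrite -[(Q _).[x] ^+ 2]real_normK ?num_real // -exprMn.
  by rewrite ler_pXn2r ?nnegrE ?mulr_ge0 // ltW.
have k2 : `|x| ^+ 2 * (Q n.+2).[x] ^+ 2 <= (B / 2 ^+ k) ^+ 2.
  rewrite -[(Q _).[x] ^+ 2]real_normK ?num_real // -exprMn.
  rewrite ler_pXn2r ?nnegrE ?(ltW b0) ?mulr_ge0 //.
  by rewrite (le_trans _ h2') // ler_piMl // ltW.
rewrite mulrCA; apply: (@le_trans _ _ (1 * (`|x| ^+ 2 *
    ((Q n.+1).[x] ^+ 2 + (Q n.+2).[x] ^+ 2)))).
  by rewrite ler_wpM2r // mulr_ge0 ?addr_ge0 ?sqr_ge0 // ltW.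
rewrite mul1r mulrDr; apply: (le_trans (lerD k1 k2)).
by rewrite exprMn; have := sqr_ge0 (B / 2 ^+ k); lra.
Qed.

Lemma support_near1 r : r < 1 -> exists2 y, measure_support mu y & r < y < 1.
Proof.
wlog r0 : r / 0 <= r.
  move=> H r1; have [||y yS /andP[y0 y1]] := H (Num.max r 0).
  - by rewrite le_max lexx orbT.
  - by rewrite gt_max r1 ltr01.
  by exists y => //; rewrite y1 andbT; apply: le_lt_trans y0; rewrite le_max lexx.
move=> r1; apply: contrapT => H.
have noS y : measure_support mu y -> r < y < 1 -> False.
  by move=> yS yr; apply: H; exists y.
pose V : set R := `]r, 1[ `|` `]-1, -r[ `|` `]1, +oo[ `|` `]-oo, -1[.
have V0 : mu V = 0%E.
  apply: open_null; first by do 3?[apply: openU]; exact: interval_open.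
  move=> y Vy yS; have Dy := support_sub_dual yS.
  have := dual_space_le1 lam_adm Dy; rewrite ler_norml => /andP[y1 y2].
  case: Vy => [[[]|]|]; rewrite /= in_itv /= ?andbT => ry.
  - exact: noS yS ry.
  (* The reflection passes through the dual space, whose symmetry is known. *)
  - have /andP[ry1 ry2] := ry; apply: (noS (- y)); last by apply/andP; split; lra.
    apply: dual_sub_support; first exact: dual_space_opp.
    by rewrite normrN ltr_norml; apply/andP; split; lra.
  - lra.
  - lra.
(* An atom at 1 or -1 times Q_(2n)(1)^2 would be at most the integral 1 of Q_(2n)^2, but Q_(2n)(1)
   grows like 2^n at least. *)
have pt0 z : `|z| = 1 -> mu [set z] = 0%E.
  move=> z1; set A := [set z].
  suff : (mu A <= 0)%E by move=> A0; apply/eqP; rewrite -measure_le0.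
  have mz : measurable (A : set (measurableTypeR R)) by exact: measurable_set1.
  have muz : mu A \is a fin_num by exact: fin_num_measure.
  rewrite -(fineK muz) lee_fin leNgt; apply/negP => m0.
  have [n] := exists_expr2_gt (fine (mu A))^-1.
  rewrite -[_^-1]mul1r ltr_pdivrMr //; apply/negP; rewrite -leNgt.
  have Qz : `|(Q n.*2).[z]| = (Q n.*2).[1].
    have q0 := Q_at1_gt0 lam_adm n.*2.
    move/eqP: z1; rewrite eqr_norml ler01 andbT => /orP[/eqP ->|/eqP ->].
      by rewrite gtr0_norm.
    by rewrite (Q_opp lam_adm) normrM normrX normrN1 expr1n mul1r gtr0_norm.
  have : ((2 ^+ n)%:E * mu A <= (I (Q n.*2 * Q n.*2))%:E)%E.
    apply: (poly_int_markov integrable_poly mz) => [|y|_ ->].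
    - by rewrite exprn_ge0.
    - by rewrite hornerM -expr2 sqr_ge0.
    rewrite hornerM -expr2 -[_ ^+ 2]real_normK ?num_real // Qz.
    apply: (le_trans (Q_at1_expr lam_adm n)); rewrite ler_eXnr //.
    by apply: le_trans (Q_at1_expr lam_adm n); rewrite exprn_ege1 // ler1n.
  by rewrite poly_int_QQ eqxx -(fineK muz) -EFinM lee_fin.
pose N : set (measurableTypeR R) := V `|` [set 1] `|` [set -1].
have mV : measurable (V : set (measurableTypeR R)).
  by apply: open_measurable; do 3?[apply: openU]; exact: interval_open.
have mN : measurable N by do 2?[apply: measurableU].
have N0 : mu N = 0%E.
  apply: measure_negligible => //; do 2?[apply: negligibleU];
    apply/negligibleP => //; apply: pt0; rewrite ?normrN normr1 //.
have e_le n : lam n.*2 ^+ 2 <= r ^+ 2.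
  have : 0 <= I (r ^+ 2 *: (Q n.*2 * Q n.*2) - ('X * Q n.*2) ^+ 2).
    apply: (poly_int_ge0 integrable_poly mN N0) => y Ny.
    rewrite hornerD hornerN hornerZ horner_exp !hornerM hornerX exprMn -expr2 -mulrBl.
    rewrite mulr_ge0 ?sqr_ge0 // subr_ge0 -[y ^+ 2]real_normK ?num_real //.
    rewrite ler_pXn2r ?nnegrE // leNgt; apply/negP; rewrite ltr_normr => ry; apply: Ny.
    rewrite /N /V /= !in_itv /= !andbT; case/orP: ry => ry.
      case: (ltgtP y 1) => [y1|y1|->]; last by left; right.
        by do 5 left; rewrite ry.
      by do 3 left; right.
    case: (ltgtP y (-1)) => [y1|y1|->]; last by right.
      by do 2 left; right.
    by do 4 left; right; rewrite ?y1 /=; lra.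
  rewrite intB intZ poly_int_QX poly_int_QQ eqxx mulr1 subr_ge0.
  by apply: le_trans; rewrite lerDl sqr_ge0.
have /cvgrPdist_lt /(_ (1 - r)) := lam_even_cvg lam_adm.
rewrite subr_gt0 => /(_ r1) [n _ /(_ n (leqnn n))] /=.
have l0 := lam_gt0 lam_adm n.*2.
have : lam n.*2 <= r by have := e_le n; rewrite ler_pXn2r ?nnegrE ?(ltW l0).
by move=> lr; rewrite ltr_norml => /andP[_]; lra.
Qed.

End Orthogonality.

(** * The dual space and the support as a set of nodes *)

Lemma dual_space_structure (R : realType) (lam : nat -> R)
    (mu : probability (measurableTypeR R) R) :
  admissible lam -> orthogonalization_measure (Ppoly lam) mu ->
  exists x : nat -> R,
    [/\ node_sequence x,
        dual_space (Ppoly lam) = measure_support mu &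
        measure_support mu = node_set x].
Proof.
move=> lam_adm mu_orth.
pose D := [set x : R | dual_space (Ppoly lam) x /\ 0 < x < 1].
have supp_dual := support_sub_dual lam_adm mu_orth.
have dual_supp := dual_sub_support lam_adm mu_orth.
have near1 r : r < 1 -> exists2 y, D y & r < y.
  move=> r1; have r1' : Num.max r 0 < 1 by rewrite gt_max r1 ltr01.
  have [y yS] := support_near1 lam_adm mu_orth r1'.
  rewrite gt_max => /andP[/andP[ry y0] y1]; exists y => //.
  by split; [exact: supp_dual|rewrite y0 y1].
have sep r : r < 1 -> exists eta, 0 < eta /\ forall x y, D x -> D y ->
    0 <= x <= r -> 0 <= y <= r -> x != y -> eta <= `|x - y|.
  move=> /(dual_space_separated lam_adm)[eta [eta0 sep]].
  by exists eta; split=> // x y [Dx _] [Dy _]; exact: sep.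
have [x [x_node xP]] := enumerate (fun y (Dy : D y) => proj2 Dy) sep near1.
have Dx n : D (x n) by apply/xP; exists n.
have supp_opp y : D y -> measure_support mu (- y).
  move=> [Dy /andP[y0 y1]]; apply: dual_supp; first exact: dual_space_opp.
  by rewrite normrN gtr0_norm.
have supp1 : measure_support mu 1.
  move=> U oU U1; have /nbhs_ballP[e e0 eU] : nbhs (1 : R) U by exact: open_nbhs_nbhs.
  have [|y [Dy /andP[y0 y1]] ey] := near1 (1 - e); first by rewrite gtrBl.
  apply: (dual_supp y Dy); rewrite ?gtr0_norm //.
  by apply: eU; rewrite /ball /= gtr0_norm ?subr_gt0 //; lra.
have suppN1 : measure_support mu (- 1).
  move=> U oU U1; have /nbhs_ballP[e e0 eU] : nbhs (-1 : R) U by exact: open_nbhs_nbhs.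
  have [|y Dy ey] := near1 (1 - e); first by rewrite gtrBl.
  apply: (supp_opp y Dy) => //; have [_ /andP[y0 y1]] := Dy.
  apply: eU; rewrite /ball /= opprK addrC ltr_norml; apply/andP; split; lra.
have dual_eq : dual_space (Ppoly lam) = measure_support mu.
  apply/seteqP; split=> y; last exact: supp_dual.
  move=> Dy; have := dual_space_le1 lam_adm Dy; rewrite le_eqVlt => /orP[|y1].
    by rewrite eqr_norml ler01 andbT => /orP[/eqP ->|/eqP ->].
  exact: dual_supp.
exists x; split=> //; apply/seteqP; split=> y.
  move=> /supp_dual Dy; have := dual_space_le1 lam_adm Dy.
  rewrite le_eqVlt => /orP[|y1].
    rewrite eqr_norml ler01 andbT => /orP[/eqP ->|/eqP ->].
      by constructor 1.
    by constructor 2.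
  constructor 3; have := y1; rewrite ltr_norml => /andP[yN1 yl1].
  have [y0|y0|y0] := ltgtP y 0.
  - have /xP[n yn] : D (- y).
      by split; [exact: dual_space_opp|apply/andP; split; lra].
    by exists n; right; rewrite -yn opprK.
  - have /xP[n yn] : D y by split=> //; rewrite y0.
    by exists n; left.
  - by move: Dy; rewrite y0 => /(dual_spaceN0 lam_adm).
case=> [->|->|[n [->|->]]] //; last exact: supp_opp.
by rewrite -dual_eq; have [] := Dx n.
Qed.

Theorem theorem3p3 (R : realType) :
  (* (i) *)
  (forall lam : nat -> R, admissible lam ->
     (forall n : nat, 0 < (Qpoly lam n).[1]) /\
     strictly_increasing (fun n : nat => (Qpoly lam n).[1])) /\
  (* (ii) *)
  (forall lam : nat -> R, admissible lam ->
     induces_polynomial_hypergroup (Ppoly lam) /\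
     (forall mu : probability (measurableTypeR R) R,
        orthogonalization_measure (Ppoly lam) mu ->
        orthonormal_polynomials mu (Qpoly lam))) /\
  (* (iii) *)
  (forall lam : nat -> R, admissible lam ->
     forall mu : probability (measurableTypeR R) R,
       orthogonalization_measure (Ppoly lam) mu ->
       exists x : nat -> R,
         [/\ node_sequence x,
             dual_space (Ppoly lam) = measure_support mu &
             measure_support mu = node_set x]) /\
  (* (iv) *)
  ((forall eps : R, 0 < eps < 1 ->
      (exists lam : nat -> R,
         admissible lam /\ haar (Ppoly lam) 1%N = 1 + eps) /\
      (forall lam : nat -> R, admissible lam ->
         haar (Ppoly lam) 1%N = 1 + eps ->
         forall x : nat -> R, node_sequence x ->
           dual_space (Ppoly lam) = node_set x ->
           forall n : nat,
             Num.sqrt ((1 - eps) / (1 + eps)) <= x n /\ x n < 1)) /\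
   (forall s : nat -> R, convex_null_sequence s ->
      admissible (lam_of s) /\
      (forall eps : R, 0 < eps < 1 ->
         s 0%N = 1 - 1 / Num.sqrt (1 + eps) ->
         haar (Ppoly (lam_of s)) 1%N = 1 + eps))) /\
  (* (v) *)
  (forall lam : nat -> R, admissible lam ->
     [/\ forall n : nat, (2 <= n)%N -> 4 < haar (Ppoly lam) n,
         strictly_increasing (haar (Ppoly lam)) &
         exists C q : R, [/\ 0 < C, 1 < q &
           forall n : nat, C * q ^+ n <= haar (Ppoly lam) n]]).
Proof.
split; [move=> lam lam_adm|split; [move=> lam lam_adm|split; [|split]]].
- by split=> n; have /andP[] := Q_at1 lam_adm n.
- split; last by move=> mu; exact: Qpoly_orthonormal.
  by split; [exact: Ppoly_normalized|exact: Ppoly_nonneg_linearization].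
- by move=> lam lam_adm mu; exact: dual_space_structure.
- split=> [eps /andP[eps0 eps1]|s s_convex].
    split=> [|lam lam_adm h1 x [_ x01 _] DE n]; first exact: exists_haar1.
    have /andP[xn0 xn1] := x01 n; split=> //.
    apply: (dual_space_lower_bound lam_adm) => //; first exact: ltW.
    by rewrite DE; constructor 3; exists n; left.
  split=> [|eps /andP[eps0 _]]; first exact: lam_of_admissible.
  exact: haar1_lam_of.
move=> lam lam_adm; split; [exact: haar_gt4|exact: haar_incr|].
exists 2^-1, 2; split=> [||n]; [by rewrite invr_gt0|by rewrite ltr1n|].
exact: haar_expr.
Qed.
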